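(* The Feynman categories for modular operads, for their nc (non-connected) version, and for props are not equivalent to a standard plus construction $\mathcal M^+$ (of any symmetric monoidal category $\mathcal M$).
   Context: **Standard plus construction.** For a symmetric monoidal category $\mathcal M$, $\mathcal M^+$ is the symmetric monoidal category (product $\otimes$) obtained from the groupoid whose objects are the morphisms $\phi$ of $\mathcal M$ and whose morphisms are $(\sigma\Downarrow\sigma'):\phi\to\sigma'\phi\sigma^{-1}$ with $\sigma,\sigma'$ isomorphisms of $\mathcal M$, by adjoining $\bar\gamma_{\phi_1,\phi_0}:\phi_1\otimes\phi_0\to\phi_1\circ\phi_0$ for composable pairs, modulo outer equivariance $(\sigma\Downarrow\sigma')\bar\gamma_{\phi_1,\phi_0}=\bar\gamma_{\sigma'\phi_1,\phi_0\sigma^{-1}}[(id\Downarrow\sigma')\otimes(\sigma\Downarrow id)]$, inner equivariance $\bar\gamma_{\phi_1,\sigma\phi_0}[id\otimes(id\Downarrow\sigma)]=\bar\gamma_{\phi_1\sigma,\phi_0}[(\sigma^{-1}\Downarrow id)\otimes id]$, associativity, and interchange $\bar\gamma_{\phi_0\otimes\psi_0,\phi_1\otimes\psi_1}=\bar\gamma_{\phi_0,\phi_1}\otimes\bar\gamma_{\psi_0,\psi_1}$ (up to the evident commutativity constraint). **Feynman category**: $(\mathcal V,\mathcal F,\imath)$, $\mathcal V$ a groupoid, $\mathcal F$ symmetric monoidal, $\imath:\mathcal V\to\mathcal F$, with $\mathcal V^\boxtimes\simeq\mathrm{Iso}(\mathcal F)$, $\mathrm{Iso}(\mathcal F\downarrow\mathcal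 V)^\boxtimes\simeq\mathrm{Iso}(\mathcal F\downarrow\mathcal F)$ (free symmetric monoidal categories) and essentially small slices; basic morphisms have target in $\imath(\mathcal V)$. **Graphs.** An aggregate is $(V,F,\partial:F\to V)$ with $V$ finite set of vertices, $F$ finite set of flags; a corolla is an aggregate with one vertex; the monoidal product is disjoint union. A morphism is $(\phi_V,\phi^F,i_\phi)$ with $\phi_V:V\to V'$ surjective, $\phi^F:F'\to F$ injective, $i_\phi$ a fixed-point-free involution on $F\setminus\phi^F(F')$, such that $\phi_V\partial\phi^F=\partial'$ and $\phi_V\partial i_\phi=\phi_V\partial$ on $F\setminus\phi^F(F')$. The ghost graph is the graph with vertices $V$, flags $F$, and edges the orbits of $i_\phi$. Directed aggregates have flags marked in/out, preserved by $\phi^F$ and with $i_\phi$ pairing in- with out-flags. *Modular operads*: objects are aggregates whose vertices carry a genus in $\mathbb N_0$; basic morphisms (to one corolla) have connected ghost graph, and the genus of the target vertex is the sum of the genera of the source vertices plus the first Betti number of the ghost graph. They are generated by edge contractions and loop contractions. *nc version*: for a monoidal category $(\mathcal F,\otimes)$, $\mathcal F^{nc}$ is obtained from the free symmetric monoidal category $\mathcal F^\boxtimes$ by adjoining morphisms $\mu_{X,Y}:X\boxtimes Y\to X\otimes Y$ and $\epsilon:1_\boxtimes\to1_{\mathcal F}$ realizing the data of the monoidal product as a lax structure (so strict monoidal functors out of $\mathcal F^{nc}$ are lax monoidal functors out of $\mathcal F$); the nc version of modular operads is this construction for the Feynman category of modular operads (it allows non-connected graphs, i.e. mergers). *Props*: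 objects are directed aggregates; morphisms are generated by isomorphisms, mergers (basic morphisms with no ghost edges), two-level contractions (basic morphisms $a_{i_1,o_1}\amalg a_{i_2,o_2}\to *_{i_1,o_2}$ from a disjoint union of two aggregates, whose ghost edges are given by a bijection of all out-flags $o_1$ of the first with all in-flags $i_2$ of the second), together with a unit morphism $u:\emptyset\to *_{1,1}$ that is a unit for these contractions. *)

(* Defs.v *)
From Stdlib Require Import Setoid Morphisms RelationClasses.
From mathcomp Require Import all_boot ssralg ssrint zify.

Set Implicit Arguments.
Unset Strict Implicit.
Unset Printing Implicit Defensive.

(* Hom-sets carry an explicit equivalence relation f ≈ g, which plays the role of
   equality of morphisms: categories given by generators and relations then need
   no quotient types. *)

Declare Scope cat_scope.
Delimit Scope cat_scope with cat.
Local Open Scope cat_scope.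

Reserved Notation "f ≈ g" (at level 70, no associativity).
Reserved Notation "g ∘ f" (at level 40, left associativity).
Reserved Notation "x ⊗ y" (at level 37, left associativity).
Reserved Notation "f ⊗ₕ g" (at level 37, left associativity).

Record category := Category {
  ob :> Type;
  hom : ob -> ob -> Type;
  heq : forall x y, hom x y -> hom x y -> Prop;
  idm : forall x, hom x x;
  comp : forall x y z, hom y z -> hom x y -> hom x z;
  heq_equiv : forall x y, Equivalence (@heq x y);
  comp_cong : forall x y z (g g' : hom y z) (f f' : hom x y),
    heq g g' -> heq f f' -> heq (comp g f) (comp g' f');
  compA : forall w x y z (h : hom y z) (g : hom x y) (f : hom w x),
    heq (comp h (comp g f)) (comp (comp h g) f);
  comp1m : forall x y (f : hom x y), heq (comp (idm y) f) f;
  compm1 : forall x y (f : hom x y), heq (comp f (idm x)) f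
}.
Arguments hom {c} x y.
Arguments heq {c x y} f g.
Arguments idm {c} x.
Arguments comp {c x y z} g f.
Notation "f ≈ g" := (heq f g) : cat_scope.
Notation "g ∘ f" := (comp g f) : cat_scope.

#[global] Instance heq_Equivalence (C : category) (x y : C) :
  Equivalence (@heq C x y) := heq_equiv x y.
#[global] Hint Extern 0 (heq _ _) => reflexivity : core.
#[global] Instance comp_Proper (C : category) (x y z : C) :
  Proper (heq ==> heq ==> heq) (@comp C x y z).
Proof. by move=> g g' eg f f' ef; apply: comp_cong. Qed.

Record iso (C : category) (x y : C) := Iso {
  fwd :> hom x y;
  bwd : hom y x;
  bwdK : bwd ∘ fwd ≈ idm x;
  fwdK : fwd ∘ bwd ≈ idm y
}.

Definition iso_id (C : category) (x : C) : iso x x :=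
  Iso (comp1m (idm x)) (comp1m (idm x)).

Definition iso_inv (C : category) (x y : C) (s : iso x y) : iso y x :=
  Iso (fwdK s) (bwdK s).

Definition iso_comp (C : category) (x y z : C) (t : iso y z) (s : iso x y) :
  iso x z.
Proof.
apply: (@Iso C x z (fwd t ∘ fwd s) (bwd s ∘ bwd t)).
- by rewrite -compA (compA (bwd t)) bwdK comp1m bwdK.
- by rewrite -compA (compA (fwd s)) fwdK comp1m fwdK.
Defined.

Record smc := SMC {
  scat :> category;
  tens : scat -> scat -> scat;
  unit_ob : scat;
  tensm : forall x x' y y', @hom scat x x' -> @hom scat y y' ->
    @hom scat (tens x y) (tens x' y');
  tensm_cong : forall x x' y y' (f f' : @hom scat x x') (g g' : @hom scat y y'),
    f ≈ f' -> g ≈ g' -> tensm f g ≈ tensm f' g';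
  tensm1 : forall x y, tensm (idm x) (idm y) ≈ idm (tens x y);
  tensm_comp : forall x x' x'' y y' y''
      (f' : @hom scat x' x'') (f : @hom scat x x')
      (g' : @hom scat y' y'') (g : @hom scat y y'),
    tensm (f' ∘ f) (g' ∘ g) ≈ tensm f' g' ∘ tensm f g;
  assoc : forall x y z, iso (tens (tens x y) z) (tens x (tens y z));
  lunit : forall x, iso (tens unit_ob x) x;
  runit : forall x, iso (tens x unit_ob) x;
  braid : forall x y, @hom scat (tens x y) (tens y x);
  assoc_nat : forall x x' y y' z z'
      (f : @hom scat x x') (g : @hom scat y y') (h : @hom scat z z'),
    assoc x' y' z' ∘ tensm (tensm f g) h ≈ tensm f (tensm g h) ∘ assoc x y z;
  lunit_nat : forall x x' (f : @hom scat x x'),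
    lunit x' ∘ tensm (idm unit_ob) f ≈ f ∘ lunit x;
  runit_nat : forall x x' (f : @hom scat x x'),
    runit x' ∘ tensm f (idm unit_ob) ≈ f ∘ runit x;
  braid_nat : forall x x' y y' (f : @hom scat x x') (g : @hom scat y y'),
    braid x' y' ∘ tensm f g ≈ tensm g f ∘ braid x y;
  braidK : forall x y, braid y x ∘ braid x y ≈ idm (tens x y);
  pentagon : forall w x y z,
    assoc w x (tens y z) ∘ assoc (tens w x) y z ≈
    tensm (idm w) (assoc x y z) ∘ assoc w (tens x y) z
      ∘ tensm (assoc w x y) (idm z);
  triangle : forall x y,
    tensm (idm x) (lunit y) ∘ assoc x unit_ob y ≈ tensm (runit x) (idm y);
  hexagon : forall x y z,
    assoc y z x ∘ braid x (tens y z) ∘ assoc x y z ≈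
    tensm (idm y) (braid x z) ∘ assoc y x z ∘ tensm (braid x y) (idm z)
}.
Arguments tens {s} x y.
Arguments unit_ob {s}.
Arguments tensm {s x x' y y'} f g.
Arguments assoc {s} x y z.
Arguments lunit {s} x.
Arguments runit {s} x.
Arguments braid {s} x y.
Notation "x ⊗ y" := (tens x y) : cat_scope.
Notation "f ⊗ₕ g" := (tensm f g) : cat_scope.

#[global] Instance tensm_Proper (C : smc) (x x' y y' : C) :
  Proper (heq ==> heq ==> heq) (@tensm C x x' y y').
Proof. by move=> f f' ef g g' eg; apply: tensm_cong. Qed.

Definition iso_tens (C : smc) (x x' y y' : C) (s : iso x x') (t : iso y y') :
  iso (x ⊗ y) (x' ⊗ y').
Proof.
apply: (@Iso C _ _ (fwd s ⊗ₕ fwd t) (bwd s ⊗ₕ bwd t)).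
- by rewrite -tensm_comp !bwdK tensm1.
- by rewrite -tensm_comp !fwdK tensm1.
Defined.

Definition iso_braid (C : smc) (x y : C) : iso (x ⊗ y) (y ⊗ x) :=
  Iso (braidK x y) (braidK y x).

Definition mid_swap (C : smc) (a b c d : C) :
    hom ((a ⊗ b) ⊗ (c ⊗ d)) ((a ⊗ c) ⊗ (b ⊗ d)) :=
  bwd (assoc a c (b ⊗ d))
  ∘ (idm a ⊗ₕ (assoc c b d ∘ (braid b c ⊗ₕ idm d) ∘ bwd (assoc b c d)))
  ∘ assoc a b (c ⊗ d).

Record functor (C D : category) := Functor {
  fob :> C -> D;
  fhom : forall x y : C, hom x y -> hom (fob x) (fob y);
  fhom_cong : forall (x y : C) (f g : hom x y), f ≈ g -> fhom f ≈ fhom g;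
  fhom1 : forall x : C, fhom (idm x) ≈ idm (fob x);
  fhom_comp : forall (x y z : C) (g : hom y z) (f : hom x y),
    fhom (g ∘ f) ≈ fhom g ∘ fhom f
}.

Definition functor_id (C : category) : functor C C.
Proof. by apply: (@Functor C C id (fun _ _ f => f)). Defined.

Definition functor_comp (C D E : category) (G : functor D E) (F : functor C D) :
  functor C E.
Proof.
apply: (@Functor C E (fun x => G (F x)) (fun x y f => fhom G (fhom F f))).
- by move=> x y f g e; do 2 apply: fhom_cong.
- by move=> x; rewrite -fhom1; apply: fhom_cong; apply: fhom1.
- by move=> x y z g f; rewrite -fhom_comp; apply: fhom_cong; apply: fhom_comp.
Defined.

Record nat_iso (C D : category) (F G : functor C D) := NatIso {
  nt :> forall x : C, iso (F x) (G x);
  nt_nat : forall (x y : C) (f : hom x y), nt y ∘ fhom F f ≈ fhom G f ∘ nt x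
}.

(* Symmetric monoidal functors are strong. *)
Record sm_functor (C D : smc) := SMFunctor {
  sfun :> functor C D;
  smu : forall x y : C, iso (sfun x ⊗ sfun y) (sfun (x ⊗ y));
  seps : iso unit_ob (sfun unit_ob);
  smu_nat : forall (x x' y y' : C) (f : hom x x') (g : hom y y'),
    smu x' y' ∘ (fhom sfun f ⊗ₕ fhom sfun g) ≈ fhom sfun (f ⊗ₕ g) ∘ smu x y;
  smu_assoc : forall x y z : C,
    fhom sfun (assoc x y z) ∘ smu (x ⊗ y) z ∘ (smu x y ⊗ₕ idm (sfun z)) ≈
    smu x (y ⊗ z) ∘ (idm (sfun x) ⊗ₕ smu y z)
      ∘ assoc (sfun x) (sfun y) (sfun z);
  smu_lunit : forall x : C,
    fhom sfun (lunit x) ∘ smu unit_ob x ∘ (seps ⊗ₕ idm (sfun x)) ≈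
    lunit (sfun x);
  smu_runit : forall x : C,
    fhom sfun (runit x) ∘ smu x unit_ob ∘ (idm (sfun x) ⊗ₕ seps) ≈
    runit (sfun x);
  smu_braid : forall x y : C,
    fhom sfun (braid x y) ∘ smu x y ≈ smu y x ∘ braid (sfun x) (sfun y)
}.

(* Equivalence as symmetric monoidal categories.  For a Feynman category (V, F, i)
   this concerns F only, so an equivalence of Feynman categories is in particular
   an sm_equivalent pair. *)
Definition sm_equivalent (C D : smc) : Prop :=
  exists (F : sm_functor C D) (G : functor D C),
    inhabited (nat_iso (functor_comp G F) (functor_id C)) /\
    inhabited (nat_iso (functor_comp F G) (functor_id D)).

Section Adjoin.
Variables (C : smc) (G : C -> C -> Type).

Inductive aterm : C -> C -> Type :=
| ain x y : hom x y -> aterm x y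
| agen x y : G x y -> aterm x y
| acomp x y z : aterm y z -> aterm x y -> aterm x z
| atens x x' y y' : aterm x x' -> aterm y y' -> aterm (x ⊗ y) (x' ⊗ y').

Variable R : forall x y, aterm x y -> aterm x y -> Prop.

(* The smallest congruence containing R for which the terms form a symmetric
   monoidal category and ain a strict symmetric monoidal functor from C. *)
Inductive aeq : forall x y, aterm x y -> aterm x y -> Prop :=
| aeq_refl x y (s : aterm x y) : aeq s s
| aeq_sym x y (s t : aterm x y) : aeq s t -> aeq t s
| aeq_trans x y (s t u : aterm x y) : aeq s t -> aeq t u -> aeq s u
| aeq_comp x y z (s s' : aterm y z) (t t' : aterm x y) :
    aeq s s' -> aeq t t' -> aeq (acomp s t) (acomp s' t')
| aeq_tens x x' y y' (s s' : aterm x x') (t t' : aterm y y') :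
    aeq s s' -> aeq t t' -> aeq (atens s t) (atens s' t')
| aeq_in x y (f g : hom x y) : f ≈ g -> aeq (ain f) (ain g)
| aeq_in_comp x y z (g : hom y z) (f : hom x y) :
    aeq (ain (g ∘ f)) (acomp (ain g) (ain f))
| aeq_in_tens x x' y y' (f : hom x x') (g : hom y y') :
    aeq (ain (f ⊗ₕ g)) (atens (ain f) (ain g))
| aeq_compA w x y z (s : aterm y z) (t : aterm x y) (u : aterm w x) :
    aeq (acomp s (acomp t u)) (acomp (acomp s t) u)
| aeq_comp1m x y (s : aterm x y) : aeq (acomp (ain (idm y)) s) s
| aeq_compm1 x y (s : aterm x y) : aeq (acomp s (ain (idm x))) s
| aeq_tens_comp x x' x'' y y' y'' (s' : aterm x' x'') (s : aterm x x')
      (t' : aterm y' y'') (t : aterm y y') :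
    aeq (atens (acomp s' s) (acomp t' t)) (acomp (atens s' t') (atens s t))
| aeq_assoc x x' y y' z z' (s : aterm x x') (t : aterm y y') (u : aterm z z') :
    aeq (acomp (ain (assoc x' y' z')) (atens (atens s t) u))
        (acomp (atens s (atens t u)) (ain (assoc x y z)))
| aeq_lunit x x' (s : aterm x x') :
    aeq (acomp (ain (lunit x')) (atens (ain (idm unit_ob)) s))
        (acomp s (ain (lunit x)))
| aeq_runit x x' (s : aterm x x') :
    aeq (acomp (ain (runit x')) (atens s (ain (idm unit_ob))))
        (acomp s (ain (runit x)))
| aeq_braid x x' y y' (s : aterm x x') (t : aterm y y') :
    aeq (acomp (ain (braid x' y')) (atens s t))
        (acomp (atens t s) (ain (braid x y)))
| aeq_rel x y (s t : aterm x y) : R s t -> aeq s t.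

Definition adjoin_cat : category.
Proof.
apply: (@Category C aterm aeq (fun x => ain (idm x)) acomp).
- move=> x y; split=> [s|s t|s t u]; [exact: aeq_refl|exact: aeq_sym|].
  exact: aeq_trans.
- exact: aeq_comp.
- exact: aeq_compA.
- exact: aeq_comp1m.
- exact: aeq_compm1.
Defined.

Lemma aeq_in2 x y z (g : hom y z) (f : hom x y) h :
  g ∘ f ≈ h -> aeq (acomp (ain g) (ain f)) (ain h).
Proof.
by move=> e; apply: aeq_trans (aeq_sym (aeq_in_comp _ _)) (aeq_in e).
Qed.

Definition adjoin_iso (x y : C) (s : iso x y) : @iso adjoin_cat x y :=
  @Iso adjoin_cat x y (ain s) (ain (bwd s)) (aeq_in2 (bwdK s))
    (aeq_in2 (fwdK s)).

Definition adjoin : smc.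
Proof.
apply: (@SMC adjoin_cat tens unit_ob atens aeq_tens _ aeq_tens_comp
  (fun x y z => adjoin_iso (assoc x y z)) (fun x => adjoin_iso (lunit x))
  (fun x => adjoin_iso (runit x)) (fun x y => ain (braid x y))
  aeq_assoc aeq_lunit aeq_runit aeq_braid).
- move=> x y; apply: aeq_trans (aeq_sym (aeq_in_tens _ _)) _.
  exact: aeq_in (tensm1 x y).
- by move=> x y; apply: aeq_in2; apply: braidK.
- move=> w x y z; rewrite /= /heq /=.
  apply: aeq_trans (aeq_in2 (pentagon w x y z)) _.
  apply: aeq_trans (aeq_in_comp _ _) _; apply: aeq_comp (aeq_in_tens _ _).
  apply: aeq_trans (aeq_in_comp _ _) _; apply: aeq_comp (aeq_refl _).
  exact: aeq_in_tens.
- move=> x y; rewrite /= /heq /=.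
  apply: aeq_trans (aeq_comp (aeq_sym (aeq_in_tens _ _)) (aeq_refl _)) _.
  by apply: aeq_trans (aeq_in2 (triangle x y)) (aeq_in_tens _ _).
- move=> x y z; rewrite /= /heq /=.
  apply: aeq_trans (aeq_comp (aeq_sym (aeq_in_comp _ _)) (aeq_refl _)) _.
  apply: aeq_trans (aeq_in2 (hexagon x y z)) _.
  apply: aeq_trans (aeq_in_comp _ _) _; apply: aeq_comp (aeq_in_tens _ _).
  apply: aeq_trans (aeq_in_comp _ _) _; apply: aeq_comp (aeq_refl _).
  exact: aeq_in_tens.
Defined.

End Adjoin.
Arguments ain {C} G {x y}.
Arguments agen {C} G {x y}.

Section Plus.
Variable M : smc.

Record arrow := Arrow { asrc : M; atgt : M; amor : hom asrc atgt }.
Arguments Arrow {asrc atgt} amor.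

(* (σ ⇓ σ') : φ -> ψ is a pair of isomorphisms with ψ = σ' φ σ^-1. *)
Record down (f g : arrow) := Down {
  dsrc : iso (asrc f) (asrc g);
  dtgt : iso (atgt f) (atgt g);
  dsq : amor g ≈ dtgt ∘ amor f ∘ bwd dsrc
}.

Lemma down_sq (f g : arrow) (d : down f g) :
  amor g ∘ dsrc d ≈ dtgt d ∘ amor f.
Proof. by rewrite (dsq d) -compA bwdK compm1. Qed.

Definition mk_down (f g : arrow) (s : iso (asrc f) (asrc g))
  (t : iso (atgt f) (atgt g)) (e : amor g ∘ s ≈ t ∘ amor f) : down f g.
Proof.
apply: (@Down f g s t).
by rewrite -e -compA fwdK compm1.
Defined.

Definition down_eq (f g : arrow) (d d' : down f g) : Prop :=
  fwd (dsrc d) ≈ fwd (dsrc d') /\ fwd (dtgt d) ≈ fwd (dtgt d').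

Definition down_id (f : arrow) : down f f.
Proof.
apply: (@mk_down f f (iso_id _) (iso_id _)).
by rewrite /= comp1m compm1.
Defined.

Definition down_comp (f g h : arrow) (d' : down g h) (d : down f g) : down f h.
Proof.
apply: (@mk_down f h (iso_comp (dsrc d') (dsrc d))
  (iso_comp (dtgt d') (dtgt d))).
by rewrite /= compA down_sq -compA down_sq compA.
Defined.

Definition down_inv (f g : arrow) (d : down f g) : down g f.
Proof.
apply: (@mk_down g f (iso_inv (dsrc d)) (iso_inv (dtgt d))).
by rewrite /= (dsq d) !compA bwdK comp1m.
Defined.

Definition arr_cat : category.
Proof.
apply: (@Category arrow down down_eq down_id down_comp).
- move=> f g; split=> [d|d d' [e1 e2]|d d' d'' [e1 e2] [e3 e4]].
  + by split.
  + by split; symmetry.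
  + by split; [rewrite e1 e3|rewrite e2 e4].
- move=> f g h d d' k k' [e1 e2] [e3 e4].
  by split=> /=; [rewrite e1 e3|rewrite e2 e4].
- by move=> *; split; apply: compA.
- by move=> *; split; apply: comp1m.
- by move=> *; split; apply: compm1.
Defined.

Definition arr_iso (f g : arr_cat) (d : down f g) : iso f g.
Proof.
apply: (@Iso arr_cat f g d (down_inv d)).
- by split; apply: bwdK.
- by split; apply: fwdK.
Defined.

Definition arr_tens (f g : arr_cat) : arr_cat := Arrow (amor f ⊗ₕ amor g).

Definition down_tens (f f' g g' : arr_cat) (d : hom f f') (k : hom g g') :
  hom (arr_tens f g) (arr_tens f' g').
Proof.
apply: (@mk_down (arr_tens f g) (arr_tens f' g')
  (iso_tens (dsrc d) (dsrc k)) (iso_tens (dtgt d) (dtgt k))).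
by rewrite /= -!tensm_comp !down_sq.
Defined.

Definition arr_unit : arr_cat := Arrow (idm (@unit_ob M)).

Definition arr_assoc (f g h : arr_cat) :
  iso (arr_tens (arr_tens f g) h) (arr_tens f (arr_tens g h)).
Proof.
apply: arr_iso; apply: (@mk_down (arr_tens (arr_tens f g) h)
  (arr_tens f (arr_tens g h)) (assoc _ _ _) (assoc _ _ _)).
by rewrite /= assoc_nat.
Defined.

Definition arr_lunit (f : arr_cat) : iso (arr_tens arr_unit f) f.
Proof.
apply: arr_iso; apply: (@mk_down (arr_tens arr_unit f) f (lunit _) (lunit _)).
by rewrite /= lunit_nat.
Defined.

Definition arr_runit (f : arr_cat) : iso (arr_tens f arr_unit) f.
Proof.
apply: arr_iso; apply: (@mk_down (arr_tens f arr_unit) f (runit _) (runit _)).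
by rewrite /= runit_nat.
Defined.

Definition arr_braid (f g : arr_cat) : hom (arr_tens f g) (arr_tens g f).
Proof.
apply: (@mk_down (arr_tens f g) (arr_tens g f)
  (iso_braid _ _) (iso_braid _ _)).
by rewrite /= braid_nat.
Defined.

Definition arr_smc : smc.
Proof.
apply: (@SMC arr_cat arr_tens arr_unit down_tens _ _ _
  arr_assoc arr_lunit arr_runit arr_braid).
- by move=> f f' g g' d d' k k' [e1 e2] [e3 e4]; split; apply: tensm_cong.
- by move=> *; split; apply: tensm1.
- by move=> *; split; apply: tensm_comp.
- by move=> *; split; apply: assoc_nat.
- by move=> *; split; apply: lunit_nat.
- by move=> *; split; apply: runit_nat.
- by move=> *; split; apply: braid_nat.
- by move=> *; split; apply: braidK.
- by move=> *; split; apply: pentagon.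
- by move=> *; split; apply: triangle.
- by move=> *; split; apply: hexagon.
Defined.

Definition arr (x y : M) (f : hom x y) : arr_smc := Arrow f.

(* (id ⇓ id), identifying equal morphisms of M. *)
Definition down_eqv (x y : M) (f g : hom x y) (e : f ≈ g) :
  hom (arr f) (arr g).
Proof.
apply: (@mk_down (arr f) (arr g) (iso_id x) (iso_id y)).
by rewrite /= compm1 comp1m e.
Defined.

(* (id ⇓ σ) *)
Definition down_post (x y y' : M) (s : iso y y') (f : hom x y) :
  hom (arr f) (arr (s ∘ f)).
Proof.
apply: (@mk_down (arr f) (arr (s ∘ f)) (iso_id x) s).
by rewrite /= compm1.
Defined.

(* (σ ⇓ id) *)
Definition down_pre (x x' y : M) (s : iso x x') (f : hom x y) :
  hom (arr f) (arr (f ∘ bwd s)).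
Proof.
apply: (@mk_down (arr f) (arr (f ∘ bwd s)) s (iso_id y)).
by rewrite /= -compA bwdK compm1 comp1m.
Defined.

(* (σ ⇓ σ') on a composite *)
Definition down_outer (x x' y z z' : M) (s : iso x x') (t : iso z z')
  (f1 : hom y z) (f0 : hom x y) :
  hom (arr (f1 ∘ f0)) (arr ((t ∘ f1) ∘ (f0 ∘ bwd s))).
Proof.
apply: (@mk_down (arr (f1 ∘ f0)) (arr ((t ∘ f1) ∘ (f0 ∘ bwd s))) s t).
by rewrite /= -!compA bwdK compm1.
Defined.

Inductive plus_gen : arr_smc -> arr_smc -> Type :=
| Gamma x y z (f1 : hom y z) (f0 : hom x y) :
    plus_gen (arr f1 ⊗ arr f0) (arr (f1 ∘ f0)).

Notation pin := (ain plus_gen).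
Notation gamma f1 f0 := (agen plus_gen (Gamma f1 f0)).

(* The two sides of a relation may end in composites which are only ≈ in M;
   down_eqv identifies them.  plus_cong says that gamma depends on f1 and f0
   only up to ≈. *)
Inductive plus_rel : forall f g : arr_smc,
    aterm plus_gen f g -> aterm plus_gen f g -> Prop :=
| plus_cong x y z (f1 g1 : hom y z) (f0 g0 : hom x y)
      (e1 : f1 ≈ g1) (e0 : f0 ≈ g0) :
    plus_rel
      (acomp (pin (down_eqv (comp_cong e1 e0))) (gamma f1 f0))
      (acomp (gamma g1 g0) (atens (pin (down_eqv e1)) (pin (down_eqv e0))))
| plus_outer x x' y z z' (s : iso x x') (t : iso z z')
      (f1 : hom y z) (f0 : hom x y) :
    plus_rel
      (acomp (pin (down_outer s t f1 f0)) (gamma f1 f0))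
      (acomp (gamma (t ∘ f1) (f0 ∘ bwd s))
             (atens (pin (down_post t f1)) (pin (down_pre s f0))))
| plus_inner x y y' z (s : iso y y') (f1 : hom y' z) (f0 : hom x y) :
    plus_rel
      (acomp (pin (down_eqv (compA f1 s f0)))
        (acomp (gamma f1 (s ∘ f0))
               (atens (pin (idm (arr f1))) (pin (down_post s f0)))))
      (acomp (gamma (f1 ∘ s) f0)
             (atens (pin (down_pre (iso_inv s) f1)) (pin (idm (arr f0)))))
| plus_assoc w x y z (f2 : hom y z) (f1 : hom x y) (f0 : hom w x) :
    plus_rel
      (acomp (pin (down_eqv (compA f2 f1 f0)))
        (acomp (gamma f2 (f1 ∘ f0))
          (acomp (atens (pin (idm (arr f2))) (gamma f1 f0))
                 (pin (assoc (arr f2) (arr f1) (arr f0))))))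
      (acomp (gamma (f2 ∘ f1) f0)
             (atens (gamma f2 f1) (pin (idm (arr f0)))))
| plus_interchange x y z x' y' z' (f0 : hom y z) (f1 : hom x y)
      (g0 : hom y' z') (g1 : hom x' y') :
    plus_rel
      (acomp (atens (gamma f0 f1) (gamma g0 g1))
             (pin (mid_swap (arr f0) (arr g0) (arr f1) (arr g1))))
      (acomp (pin (down_eqv (symmetry (tensm_comp f0 f1 g0 g1))))
             (gamma (f0 ⊗ₕ g0) (f1 ⊗ₕ g1))).

Definition plus : smc := adjoin plus_rel.

End Plus.

Section FreeSMC.
Variable C : category.

Inductive word := Wleaf of C | Wone | Wtens of word & word.

Inductive fterm : word -> word -> Type :=
| fin x y : hom x y -> fterm (Wleaf x) (Wleaf y)
| fid a : fterm a a
| fcomp a b c : fterm b c -> fterm a b -> fterm a c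
| ftens a a' b b' :
    fterm a a' -> fterm b b' -> fterm (Wtens a b) (Wtens a' b')
| fassoc a b c : fterm (Wtens (Wtens a b) c) (Wtens a (Wtens b c))
| fassocV a b c : fterm (Wtens a (Wtens b c)) (Wtens (Wtens a b) c)
| flunit a : fterm (Wtens Wone a) a
| flunitV a : fterm a (Wtens Wone a)
| frunit a : fterm (Wtens a Wone) a
| frunitV a : fterm a (Wtens a Wone)
| fbraid a b : fterm (Wtens a b) (Wtens b a).

(* The smallest congruence for which the terms form a symmetric monoidal
   category and fin a functor from C. *)
Inductive feq : forall a b, fterm a b -> fterm a b -> Prop :=
| feq_refl a b (s : fterm a b) : feq s s
| feq_sym a b (s t : fterm a b) : feq s t -> feq t s
| feq_trans a b (s t u : fterm a b) : feq s t -> feq t u -> feq s u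
| feq_comp a b c (s s' : fterm b c) (t t' : fterm a b) :
    feq s s' -> feq t t' -> feq (fcomp s t) (fcomp s' t')
| feq_tens a a' b b' (s s' : fterm a a') (t t' : fterm b b') :
    feq s s' -> feq t t' -> feq (ftens s t) (ftens s' t')
| feq_in x y (f g : hom x y) : f ≈ g -> feq (fin f) (fin g)
| feq_in1 x : feq (fin (idm x)) (fid (Wleaf x))
| feq_in_comp x y z (g : hom y z) (f : hom x y) :
    feq (fin (g ∘ f)) (fcomp (fin g) (fin f))
| feq_compA a b c d (s : fterm c d) (t : fterm b c) (u : fterm a b) :
    feq (fcomp s (fcomp t u)) (fcomp (fcomp s t) u)
| feq_comp1m a b (s : fterm a b) : feq (fcomp (fid b) s) s
| feq_compm1 a b (s : fterm a b) : feq (fcomp s (fid a)) s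
| feq_tens1 a b : feq (ftens (fid a) (fid b)) (fid (Wtens a b))
| feq_tens_comp a a' a'' b b' b'' (s' : fterm a' a'') (s : fterm a a')
      (t' : fterm b' b'') (t : fterm b b') :
    feq (ftens (fcomp s' s) (fcomp t' t)) (fcomp (ftens s' t') (ftens s t))
| feq_assocK a b c : feq (fcomp (fassocV a b c) (fassoc a b c)) (fid _)
| feq_assocVK a b c : feq (fcomp (fassoc a b c) (fassocV a b c)) (fid _)
| feq_lunitK a : feq (fcomp (flunitV a) (flunit a)) (fid _)
| feq_lunitVK a : feq (fcomp (flunit a) (flunitV a)) (fid _)
| feq_runitK a : feq (fcomp (frunitV a) (frunit a)) (fid _)
| feq_runitVK a : feq (fcomp (frunit a) (frunitV a)) (fid _)
| feq_assoc a a' b b' c c' (s : fterm a a') (t : fterm b b') (u : fterm c c') :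
    feq (fcomp (fassoc a' b' c') (ftens (ftens s t) u))
        (fcomp (ftens s (ftens t u)) (fassoc a b c))
| feq_lunit a a' (s : fterm a a') :
    feq (fcomp (flunit a') (ftens (fid Wone) s)) (fcomp s (flunit a))
| feq_runit a a' (s : fterm a a') :
    feq (fcomp (frunit a') (ftens s (fid Wone))) (fcomp s (frunit a))
| feq_braid a a' b b' (s : fterm a a') (t : fterm b b') :
    feq (fcomp (fbraid a' b') (ftens s t)) (fcomp (ftens t s) (fbraid a b))
| feq_braidK a b : feq (fcomp (fbraid b a) (fbraid a b)) (fid _)
| feq_pentagon a b c d :
    feq (fcomp (fassoc a b (Wtens c d)) (fassoc (Wtens a b) c d))
        (fcomp (fcomp (ftens (fid a) (fassoc b c d)) (fassoc a (Wtens b c) d))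
               (ftens (fassoc a b c) (fid d)))
| feq_triangle a b :
    feq (fcomp (ftens (fid a) (flunit b)) (fassoc a Wone b))
        (ftens (frunit a) (fid b))
| feq_hexagon a b c :
    feq (fcomp (fcomp (fassoc b c a) (fbraid a (Wtens b c))) (fassoc a b c))
        (fcomp (fcomp (ftens (fid b) (fbraid a c)) (fassoc b a c))
               (ftens (fbraid a b) (fid c))).

Definition free_cat : category.
Proof.
apply: (@Category word fterm feq fid fcomp _ feq_comp feq_compA feq_comp1m
  feq_compm1).
move=> x y; split=> [s|s t|s t u]; [exact: feq_refl|exact: feq_sym|].
exact: feq_trans.
Defined.

Definition free_smc : smc :=
  @SMC free_cat Wtens Wone ftens feq_tens feq_tens1 feq_tens_comp
    (fun a b c => @Iso free_cat _ _ (fassoc a b c) (fassocV a b c)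
       (feq_assocK a b c) (feq_assocVK a b c))
    (fun a => @Iso free_cat _ _ (flunit a) (flunitV a)
       (feq_lunitK a) (feq_lunitVK a))
    (fun a => @Iso free_cat _ _ (frunit a) (frunitV a)
       (feq_runitK a) (feq_runitVK a))
    fbraid feq_assoc feq_lunit feq_runit feq_braid feq_braidK feq_pentagon
    feq_triangle feq_hexagon.

Definition leaf (x : C) : free_smc := Wleaf x.
Definition leafm (x y : C) (f : hom x y) : hom (leaf x) (leaf y) := fin f.

End FreeSMC.

Section NC.
Variable F : smc.
Local Notation lf := (@leaf F).

Inductive nc_gen : free_smc F -> free_smc F -> Type :=
| Mu x y : nc_gen (lf x ⊗ lf y) (lf (x ⊗ y))
| Eps : nc_gen unit_ob (lf unit_ob).

Notation nin := (ain nc_gen).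
Notation mu x y := (agen nc_gen (Mu x y)).
Notation eps := (agen nc_gen Eps).

(* The coherence conditions of a lax symmetric monoidal functor. *)
Inductive nc_rel : forall a b : free_smc F,
    aterm nc_gen a b -> aterm nc_gen a b -> Prop :=
| nc_nat x x' y y' (f : hom x x') (g : hom y y') :
    nc_rel (acomp (nin (leafm (f ⊗ₕ g))) (mu x y))
           (acomp (mu x' y') (atens (nin (leafm f)) (nin (leafm g))))
| nc_assoc x y z :
    nc_rel (acomp (nin (leafm (assoc x y z)))
             (acomp (mu (x ⊗ y) z) (atens (mu x y) (nin (idm (lf z))))))
           (acomp (mu x (y ⊗ z))
             (acomp (atens (nin (idm (lf x))) (mu y z))
                    (nin (assoc (lf x) (lf y) (lf z)))))
| nc_lunit x :
    nc_rel (acomp (nin (leafm (lunit x)))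
             (acomp (mu unit_ob x) (atens eps (nin (idm (lf x))))))
           (nin (lunit (lf x)))
| nc_runit x :
    nc_rel (acomp (nin (leafm (runit x)))
             (acomp (mu x unit_ob) (atens (nin (idm (lf x))) eps)))
           (nin (runit (lf x)))
| nc_braid x y :
    nc_rel (acomp (nin (leafm (braid x y))) (mu x y))
           (acomp (mu y x) (nin (braid (lf x) (lf y)))).

Definition nc : smc := adjoin nc_rel.

End NC.

Section Decorate.
Variables (C : smc) (D : C -> Type).
Variables (dtens : forall x y, D x -> D y -> D (x ⊗ y)) (dunit : D unit_ob).

Record dobj := DObj { dob : C; deco : D dob }.

Definition decorate_cat : category :=
  @Category dobj (fun a b => hom (dob a) (dob b)) (fun a b => heq)
    (fun a => idm (dob a)) (fun a b c => comp)
    (fun a b => heq_equiv (dob a) (dob b)) (fun a b c => @comp_cong C _ _ _)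
    (fun a b c d => @compA C _ _ _ _) (fun a b => @comp1m C _ _)
    (fun a b => @compm1 C _ _).

Definition decorate_iso (a b : decorate_cat) (s : iso (dob a) (dob b)) :
  iso a b := @Iso decorate_cat a b s (bwd s) (bwdK s) (fwdK s).

Definition decorate : smc.
Proof.
apply: (@SMC decorate_cat (fun a b => DObj (dtens (deco a) (deco b)))
  (DObj dunit) (fun a a' b b' f g => f ⊗ₕ g)
  _ _ _
  (fun a b c => decorate_iso (assoc (dob a) (dob b) (dob c) : iso
     (dob (DObj (dtens (dtens (deco a) (deco b)) (deco c))))
     (dob (DObj (dtens (deco a) (dtens (deco b) (deco c)))))))
  (fun a => decorate_iso (lunit (dob a) : iso
     (dob (DObj (dtens dunit (deco a)))) (dob a)))
  (fun a => decorate_iso (runit (dob a) : iso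
     (dob (DObj (dtens (deco a) dunit))) (dob a)))
  (fun a b => braid (dob a) (dob b))) => /= *.
- exact: tensm_cong.
- exact: tensm1.
- exact: tensm_comp.
- exact: assoc_nat.
- exact: lunit_nat.
- exact: runit_nat.
- exact: braid_nat.
- exact: braidK.
- exact: pentagon.
- exact: triangle.
- exact: hexagon.
Defined.

Definition und_ob (x : decorate) : C := dob x.
Definition und_mor (x y : decorate) (f : hom x y) : hom (und_ob x) (und_ob y)
  := f.
Definition structure (x : decorate) : D (und_ob x) := deco x.

End Decorate.

Record wide_closed (C : smc) (P : forall x y : C, hom x y -> Prop) : Prop :=
  WideClosed {
  wc_id : forall x, P x x (idm x);
  wc_comp : forall x y z (g : hom y z) (f : hom x y),
    P y z g -> P x y f -> P x z (g ∘ f);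
  wc_tens : forall x x' y y' (f : hom x x') (g : hom y y'),
    P x x' f -> P y y' g -> P (x ⊗ y) (x' ⊗ y') (f ⊗ₕ g);
  wc_assoc : forall x y z, P _ _ (fwd (assoc x y z));
  wc_assocV : forall x y z, P _ _ (bwd (assoc x y z));
  wc_lunit : forall x, P _ _ (fwd (lunit x));
  wc_lunitV : forall x, P _ _ (bwd (lunit x));
  wc_runit : forall x, P _ _ (fwd (runit x));
  wc_runitV : forall x, P _ _ (bwd (runit x));
  wc_braid : forall x y, P _ _ (braid x y)
}.

Section Wide.
Variables (C : smc) (P : forall x y : C, hom x y -> Prop).
Hypothesis PC : wide_closed P.

Record whom (x y : C) := WHom { wmor :> hom x y; wmorP : P wmor }.

Definition wide_cat : category.
Proof.
apply: (@Category C whom (fun x y f g => wmor f ≈ wmor g)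
  (fun x => WHom (wc_id PC x))
  (fun x y z g f => WHom (wc_comp PC (wmorP g) (wmorP f)))).
- move=> x y; split=> [f|f g|f g h] //=; [by symmetry|].
  by move=> -> ->.
- by move=> *; apply: comp_cong.
- by move=> *; apply: compA.
- by move=> *; apply: comp1m.
- by move=> *; apply: compm1.
Defined.

Definition wide_iso (x y : C) (s : iso x y) (p : P (fwd s)) (q : P (bwd s)) :
  @iso wide_cat x y :=
  @Iso wide_cat x y (WHom p) (WHom q) (bwdK s) (fwdK s).

Definition wide_smc : smc.
Proof.
apply: (@SMC wide_cat tens unit_ob
  (fun x x' y y' f g => WHom (wc_tens PC (wmorP f) (wmorP g)))
  _ _ _
  (fun x y z => wide_iso (wc_assoc PC x y z) (wc_assocV PC x y z))
  (fun x => wide_iso (wc_lunit PC x) (wc_lunitV PC x))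
  (fun x => wide_iso (wc_runit PC x) (wc_runitV PC x))
  (fun x y => WHom (wc_braid PC x y))) => *.
- exact: tensm_cong.
- exact: tensm1.
- exact: tensm_comp.
- exact: assoc_nat.
- exact: lunit_nat.
- exact: runit_nat.
- exact: braid_nat.
- exact: braidK.
- exact: pentagon.
- exact: triangle.
- exact: hexagon.
Defined.

Definition wide_ob (x : wide_smc) : C := x.
Definition wide_mor (x y : wide_smc) (f : hom x y) :
  hom (wide_ob x) (wide_ob y) := wmor f.

End Wide.

Record agg := Agg { vert : finType; flag : finType; bdry : flag -> vert }.

(* The involution i of flags \ fmap(flags') is extended to all flags by the
   identity (field ghost), so the image of fmap is exactly its set of fixed
   points. *)
Record agg_hom (a b : agg) := AggHom {
  vmap : vert a -> vert b;
  fmap : flag b -> flag a;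
  ghost : flag a -> flag a;
  vmap_surj : forall y, exists x, vmap x = y;
  fmap_inj : injective fmap;
  ghostK : involutive ghost;
  ghost_fix : forall f, (ghost f == f) = (f \in codom fmap);
  bdry_fmap : forall g, vmap (bdry (fmap g)) = bdry g;
  bdry_ghost : forall f, vmap (bdry (ghost f)) = vmap (bdry f)
}.

Definition agg_heq (a b : agg) (p q : agg_hom a b) : Prop :=
  [/\ vmap p =1 vmap q, fmap p =1 fmap q & ghost p =1 ghost q].

Lemma ghost_fmap (a b : agg) (p : agg_hom a b) g : ghost p (fmap p g) = fmap p g.
Proof. by apply/eqP; rewrite ghost_fix codom_f. Qed.

Definition relabel (a b : agg) (v : vert a -> vert b) (w : flag b -> flag a)
  (v' : vert b -> vert a) (w' : flag a -> flag b)
  (vK : cancel v' v) (wK : cancel w w') (w'K : cancel w' w)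
  (e : forall g, v (bdry (w g)) = bdry g) : agg_hom a b.
Proof.
apply: (@AggHom a b v w id) => //.
- by move=> y; exists (v' y).
- exact: can_inj wK.
- by move=> f; rewrite eqxx -[f]w'K codom_f.
Defined.

Definition agg_id (a : agg) : agg_hom a a.
Proof. by apply: (@relabel a a id id id id). Defined.

Section AggComp.
Variables (a b c : agg) (q : agg_hom b c) (p : agg_hom a b).

Definition comp_ghost (f : flag a) : flag a :=
  if [pick g | fmap p g == f] is Some g then fmap p (ghost q g) else ghost p f.

Lemma comp_ghost_in g : comp_ghost (fmap p g) = fmap p (ghost q g).
Proof.
rewrite /comp_ghost; case: pickP => [h /eqP/(@fmap_inj _ _ p) -> //|].
by move/(_ g); rewrite eqxx.
Qed.

Lemma comp_ghost_out f : f \notin codom (fmap p) -> comp_ghost f = ghost p f.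
Proof.
rewrite /comp_ghost; case: pickP => // h /eqP <-.
by rewrite codom_f.
Qed.

Lemma ghost_out f : f \notin codom (fmap p) -> ghost p f \notin codom (fmap p).
Proof. by rewrite -!ghost_fix ghostK eq_sym. Qed.

Variant agg_flag_spec : flag a -> Type :=
| AggFlagIn g : agg_flag_spec (fmap p g)
| AggFlagOut f of f \notin codom (fmap p) : agg_flag_spec f.

Lemma agg_flagP f : agg_flag_spec f.
Proof.
have [/codomP/sig_eqW [g ->]|] := boolP (f \in codom (fmap p)).
  exact: AggFlagIn.
exact: AggFlagOut.
Qed.

Definition agg_comp : agg_hom a c.
Proof.
apply: (@AggHom a c (vmap q \o vmap p) (fmap p \o fmap q) comp_ghost).
- move=> z; have [y <-] := vmap_surj q z; have [x <-] := vmap_surj p y.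
  by exists x.
- by apply: inj_comp; apply: fmap_inj.
- move=> f; case: (agg_flagP f) => [g|{}f fp].
    by rewrite !comp_ghost_in ghostK.
  by rewrite (comp_ghost_out fp) (comp_ghost_out (ghost_out fp)) ghostK.
- move=> f; case: (agg_flagP f) => [g|{}f fp].
    rewrite comp_ghost_in (inj_eq (@fmap_inj _ _ p)) ghost_fix.
    apply/codomP/codomP => [[h ->]|[h /(@fmap_inj _ _ p) ->]]; by exists h.
  rewrite (comp_ghost_out fp) ghost_fix (negbTE fp).
  apply/esym/negP => /codomP [h fE].
  by move: fp; rewrite fE /= codom_f.
- by move=> g /=; rewrite !bdry_fmap.
- move=> f /=; case: (agg_flagP f) => [g|{}f fp].
    by rewrite comp_ghost_in !bdry_fmap bdry_ghost.
  by rewrite (comp_ghost_out fp) bdry_ghost.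
Defined.

End AggComp.

Definition agg_cat : category.
Proof.
apply: (@Category agg agg_hom agg_heq agg_id agg_comp).
- move=> a b; split=> [p|p q [e1 e2 e3]|p q r [e1 e2 e3] [e4 e5 e6]].
  + by split.
  + by split; apply: fsym.
  + by split; apply: ftrans; eassumption.
- move=> a b c q q' p p' [e1 e2 e3] [e4 e5 e6]; split=> x /=.
  + by rewrite e4 e1.
  + by rewrite e2 e5.
  + case: (agg_flagP p x) => [g|{}x xp].
      by rewrite comp_ghost_in !e5 comp_ghost_in e3.
    rewrite !comp_ghost_out ?e6 //.
    by rewrite -ghost_fix -e6 ghost_fix.
- move=> a b c d r q p; split=> //= x.
  case: (agg_flagP p x) => [g|{}x xp].
    rewrite comp_ghost_in /=; case: (agg_flagP q g) => [h|{}g gq].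
      by have /= -> := comp_ghost_in r (agg_comp q p) h; rewrite comp_ghost_in.
    rewrite (comp_ghost_out _ gq) comp_ghost_out /= ?comp_ghost_in //.
    apply: contra gq => /codomP [h /(@fmap_inj _ _ p) ->]; exact: codom_f.
  rewrite (comp_ghost_out _ xp) comp_ghost_out /= ?comp_ghost_out //.
  by apply: contra xp => /codomP [h ->]; exact: codom_f.
- move=> a b p; split=> //= x; case: (agg_flagP p x) => [g|{}x xp].
    by rewrite comp_ghost_in ghost_fmap.
  by rewrite comp_ghost_out.
- by move=> a b p; split=> //= x; apply: (@comp_ghost_in _ _ _ p (agg_id a) x).
Defined.

Lemma relabel_comp (a b : agg) (p : agg_hom a b) (q : agg_hom b a) :
  ghost p =1 id -> ghost q =1 id -> cancel (vmap p) (vmap q) ->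
  cancel (fmap q) (fmap p) -> agg_heq (agg_comp q p) (agg_id a).
Proof.
move=> gp gq vK fK; split=> //= x; case: (agg_flagP p x) => [g|{}x xp].
  by rewrite comp_ghost_in gq.
by rewrite comp_ghost_out.
Qed.

Definition sum_map (A A' B B' : Type) (f : A -> A') (g : B -> B')
    (x : A + B) : A' + B' :=
  match x with inl u => inl (f u) | inr v => inr (g v) end.

Definition agg_tens (a b : agg) : agg :=
  @Agg (vert a + vert b)%type (flag a + flag b)%type
    (sum_map (@bdry a) (@bdry b)).

Definition agg_unit : agg := @Agg void void (fun x => x).

Lemma codom_sum_map (A A' B B' : finType) (f : A -> A') (g : B -> B') :
  (forall x, (inl x \in codom (sum_map f g)) = (x \in codom f)) *
  (forall x, (inr x \in codom (sum_map f g)) = (x \in codom g)).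
Proof.
split=> x; apply/codomP/codomP => [[[y|y] //= [->]]|[y ->]].
- by exists y.
- by exists (inl y).
- by exists y.
- by exists (inr y).
Qed.

Definition agg_tensm (a a' b b' : agg) (p : agg_hom a a') (q : agg_hom b b') :
  agg_hom (agg_tens a b) (agg_tens a' b').
Proof.
apply: (@AggHom (agg_tens a b) (agg_tens a' b') (sum_map (vmap p) (vmap q))
  (sum_map (fmap p) (fmap q)) (sum_map (ghost p) (ghost q))).
- move=> [y|y].
    by have [x <-] := vmap_surj p y; exists (inl x).
  by have [x <-] := vmap_surj q y; exists (inr x).
- by move=> [x|x] [y|y] //= [/(@fmap_inj _ _ _) ->].
- by move=> [x|x] /=; rewrite ghostK.
- move=> [x|x] /=.
    by rewrite (inj_eq inl_inj) ghost_fix codom_sum_map.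
  by rewrite (inj_eq inr_inj) ghost_fix codom_sum_map.
- by move=> [x|x] /=; rewrite bdry_fmap.
- by move=> [x|x] /=; rewrite bdry_ghost.
Defined.

Definition sumA (A B C : Type) (x : A + B + C) : A + (B + C) :=
  match x with
  | inl (inl u) => inl u | inl (inr v) => inr (inl v) | inr w => inr (inr w)
  end.
Definition sumAV (A B C : Type) (x : A + (B + C)) : A + B + C :=
  match x with
  | inl u => inl (inl u) | inr (inl v) => inl (inr v) | inr (inr w) => inr w
  end.
Definition suml (A : Type) (x : void + A) : A :=
  match x with inl u => match u with end | inr v => v end.
Definition sumr (A : Type) (x : A + void) : A :=
  match x with inl u => u | inr v => match v with end end.
Definition sumC (A B : Type) (x : A + B) : B + A :=
  match x with inl u => inr u | inr v => inl v end.

Lemma relabel_bdryV (a b : agg) (v : vert a -> vert b)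
  (w : flag b -> flag a) (v' : vert b -> vert a) (w' : flag a -> flag b) :
  cancel v v' -> cancel w' w -> (forall g, v (bdry (w g)) = bdry g) ->
  forall f, v' (bdry (w' f)) = bdry f.
Proof. by move=> vK w'K e f; rewrite -[RHS]vK -[f in RHS]w'K e. Qed.

Definition relabel_iso (a b : agg_cat) (v : vert a -> vert b)
  (w : flag b -> flag a) (v' : vert b -> vert a) (w' : flag a -> flag b)
  (vK : cancel v v') (v'K : cancel v' v) (wK : cancel w w') (w'K : cancel w' w)
  (e : forall g, v (bdry (w g)) = bdry g) : iso a b :=
  @Iso agg_cat a b (relabel v'K wK w'K e)
    (relabel vK w'K wK (relabel_bdryV vK w'K e))
    (@relabel_comp a b (relabel v'K wK w'K e)
      (relabel vK w'K wK (relabel_bdryV vK w'K e))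
      (fun _ => erefl) (fun _ => erefl) vK w'K)
    (@relabel_comp b a (relabel vK w'K wK (relabel_bdryV vK w'K e))
      (relabel v'K wK w'K e) (fun _ => erefl) (fun _ => erefl) v'K wK).

Lemma sumAK (A B C : Type) : cancel (@sumA A B C) (@sumAV A B C).
Proof. by case=> [[]|]. Qed.
Lemma sumAVK (A B C : Type) : cancel (@sumAV A B C) (@sumA A B C).
Proof. by case=> [|[]]. Qed.
Lemma sumlK (A : Type) : cancel (@suml A) inr.
Proof. by case. Qed.
Lemma sumrK (A : Type) : cancel (@sumr A) inl.
Proof. by case=> [|[]]. Qed.
Lemma sumCK (A B : Type) : cancel (@sumC A B) (@sumC B A).
Proof. by case. Qed.

Lemma assoc_bdry (a b c : agg) (g : flag (agg_tens a (agg_tens b c))) :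
  sumA (@bdry (agg_tens (agg_tens a b) c) (sumAV g)) = bdry g.
Proof. by case: g => [|[]]. Qed.
Lemma braid_bdry (a b : agg) (g : flag (agg_tens b a)) :
  sumC (@bdry (agg_tens a b) (sumC g)) = bdry g.
Proof. by case: g. Qed.

Definition agg_assoc (a b c : agg_cat) :
  iso (agg_tens (agg_tens a b) c : agg_cat) (agg_tens a (agg_tens b c)) :=
  @relabel_iso (agg_tens (agg_tens a b) c) (agg_tens a (agg_tens b c))
    _ _ _ _ (@sumAK _ _ _) (@sumAVK _ _ _) (@sumAVK _ _ _) (@sumAK _ _ _)
    (@assoc_bdry a b c).

Definition agg_lunit (a : agg_cat) : iso (agg_tens agg_unit a : agg_cat) a :=
  @relabel_iso (agg_tens agg_unit a) a
    (@suml _) inr inr (@suml _) (@sumlK _) (fun _ => erefl) (fun _ => erefl) (@sumlK _)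
    (fun _ => erefl).

Definition agg_runit (a : agg_cat) : iso (agg_tens a agg_unit : agg_cat) a :=
  @relabel_iso (agg_tens a agg_unit) a
    (@sumr _) inl inl (@sumr _) (@sumrK _) (fun _ => erefl) (fun _ => erefl) (@sumrK _)
    (fun _ => erefl).

Definition agg_braid (a b : agg_cat) :
  iso (agg_tens a b : agg_cat) (agg_tens b a) :=
  @relabel_iso (agg_tens a b) (agg_tens b a)
    _ _ _ _ (@sumCK _ _) (@sumCK _ _) (@sumCK _ _) (@sumCK _ _)
    (@braid_bdry a b).

Lemma comp_ghost_id (a b c : agg) (q : agg_hom b c) (p : agg_hom a b) :
  ghost q =1 id -> comp_ghost q p =1 ghost p.
Proof.
move=> e f; case: (agg_flagP p f) => [g|{}f fp]; last by rewrite comp_ghost_out.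
by rewrite comp_ghost_in e ghost_fmap.
Qed.

Lemma comp_ghost_iso (a b : agg_cat) (c : agg) (q : agg_hom b c)
    (s : iso a b) :
  comp_ghost q (fwd s) =1 fmap (fwd s) \o ghost q \o fmap (bwd s).
Proof.
move=> f /=; have [_ /(_ f) /= fE _] := bwdK s.
by rewrite -{1}fE comp_ghost_in.
Qed.

Definition agg_smc : smc.
Proof.
apply: (@SMC agg_cat agg_tens agg_unit agg_tensm _ _ _ agg_assoc agg_lunit
  agg_runit (fun a b => fwd (agg_braid a b))).
- move=> a a' b b' p p' q q' [e1 e2 e3] [e4 e5 e6].
  by split=> -[x|x] /=; rewrite ?(e1, e2, e3, e4, e5, e6).
- by move=> a b; split=> -[].
- move=> a a' a'' b b' b'' p' p q' q; split=> [[]|[]|] //= x.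
  case: (agg_flagP (agg_tensm p q) x) => [g|{}x xpq].
    by rewrite comp_ghost_in; case: g => g /=; rewrite comp_ghost_in.
  rewrite comp_ghost_out //; case: x xpq => x; rewrite codom_sum_map => xpq /=;
    by rewrite comp_ghost_out.
- move=> a a' b b' c c' p q r; split=> [[[]|]|[|[]]|x] //=.
  rewrite comp_ghost_id //; apply/esym/(etrans (comp_ghost_iso _ (agg_assoc a b c) _)) => /=.
  by case: x => [[]|].
- move=> a a' p; split=> [[[]|]||x] //=.
  rewrite comp_ghost_id //; apply/esym/(etrans (comp_ghost_iso _ (agg_lunit a) _)) => /=.
  by case: x => [[]|].
- move=> a a' p; split=> [[|[]]||x] //=.
  rewrite comp_ghost_id //; apply/esym/(etrans (comp_ghost_iso _ (agg_runit a) _)) => /=.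
  by case: x => [|[]].
- move=> a a' b b' p q; split=> [[]|[]|x] //=.
  rewrite comp_ghost_id //; apply/esym/(etrans (comp_ghost_iso _ (agg_braid a b) _)) => /=.
  by case: x.
- move=> a b; split=> [[]|[]|x] //=.
  by rewrite comp_ghost_id.
- move=> a b c d; split=> [[[[]|]|]|[|[|[]]]|x] //=.
  rewrite !comp_ghost_id //=; first by case: x.
  by move=> z; rewrite comp_ghost_id // => -[].
- move=> a b; split=> [[[|[]]|]|[]|x] //=.
  rewrite comp_ghost_id; last by case.
  by case: x => [[|[]]|].
- move=> a b c; split=> [[[]|]|[|[]]|x] //=.
  rewrite !comp_ghost_id //=; first by case: x => [[]|].
    by move=> z; rewrite comp_ghost_id // => -[].
  by move=> z; rewrite comp_ghost_id.
Defined.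

Section GhostGraph.
Variables (a b : agg) (p : agg_hom a b).

Definition ghost_adj : rel (vert a) := fun x y =>
  [exists f, [&& ghost p f != f, bdry f == x & bdry (ghost p f) == y]].

(* The ghost graph is the disjoint union of its parts over the vertices v of b,
   with the following vertices and half-edges; its edges over v are the orbits
   of the involution on those half-edges. *)
Definition vfiber (v : vert b) : pred (vert a) := fun x => vmap p x == v.
Definition half_edges (v : vert b) : pred (flag a) :=
  fun f => (ghost p f != f) && (vmap p (bdry f) == v).
Definition n_edges (v : vert b) : nat := fcard (ghost p) (half_edges v).

Definition betti1 (v : vert b) : int :=
  ((n_edges v)%:Z - #|vfiber v|%:Z + (n_comp ghost_adj (vfiber v))%:Z)%R.

(* The ghost graph is connected over every vertex of b, i.e. p is a disjoint
   union of basic morphisms with connected ghost graph. *)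
Definition ghost_connected : Prop :=
  forall x y, vmap p x = vmap p y -> connect ghost_adj x y.

Lemma ghost_adj_sym : symmetric ghost_adj.
Proof.
move=> x y; apply/existsP/existsP => -[f /and3P[h1 h2 h3]];
  by exists (ghost p f); rewrite ghostK eq_sym h1 h2 h3.
Qed.

Lemma ghost_adj_over x y : connect ghost_adj x y -> vmap p x = vmap p y.
Proof.
case/connectP => s; elim: s x => [|z s IH] x /= => [_ -> //|].
case/andP => /existsP[f /and3P[_ /eqP <- /eqP zE]] /IH h /h <-.
by rewrite -zE bdry_ghost.
Qed.

Lemma n_comp_over v : ghost_connected -> n_comp ghost_adj (vfiber v) = 1%N.
Proof.
move=> pc; have [x xv] := vmap_surj p v.
rewrite (@eq_n_comp_r _ _ (vfiber v) (connect ghost_adj x)).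
  by apply: n_comp_connect; apply: sym_connect_sym; apply: ghost_adj_sym.
move=> y; rewrite !inE; apply/eqP/idP => [yv|/ghost_adj_over <- //].
by apply: pc; rewrite xv yv.
Qed.

Lemma n_edges_double v : (n_edges v * 2)%N = #|half_edges v|.
Proof.
apply: fcard_order_set => //; first exact: inv_inj (@ghostK _ _ p).
  apply/subsetP => f /andP[fp _].
  rewrite /order_set inE; apply/eqP.
  have cyc : fcycle (ghost p) [:: f; ghost p f] by rewrite /= ghostK !eqxx.
  have u : uniq [:: f; ghost p f] by rewrite /= inE eq_sym fp.
  by rewrite (order_cycle cyc u (mem_head _ _)).
move=> f g /eqP <-; rewrite /in_mem /= /half_edges ghostK bdry_ghost.
by rewrite [ghost p f == f]eq_sym.
Qed.

Lemma sum1_over v : (\sum_(x | vfiber v x) 1 = #|vfiber v|)%N.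
Proof. by rewrite -sum1_card. Qed.

Lemma sum1_half_edges v : (\sum_(f | half_edges v f) 1 = n_edges v * 2)%N.
Proof. by rewrite n_edges_double -sum1_card. Qed.

End GhostGraph.

Definition genus_agg : smc := @decorate agg_smc (fun a => vert a -> nat)
  (fun a b g h x => match x with inl u => g u | inr v => h v end)
  (fun x : void => match x with end).

Definition modular_mor (x y : genus_agg) (p : hom x y) : Prop :=
  ghost_connected p /\
  forall v, Posz (deco y v) =
    ((\sum_(u | vfiber p v u) deco x u)%N%:Z + betti1 p v)%R.

Lemma modular_morE (x y : genus_agg) (p : hom x y) :
  modular_mor p <-> ghost_connected p /\
  forall v, (2 * (deco y v + \sum_(u | vfiber p v u) 1) =
    2 * (\sum_(u | vfiber p v u) deco x u) + \sum_(f | half_edges p v f) 1 + 2)%N.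
Proof.
split=> -[pc h]; split=> // v; move: (h v);
  rewrite /betti1 n_comp_over // sum1_over sum1_half_edges; lia.
Qed.

Lemma modular_relabel (x y : genus_agg) (p : hom x y) :
  ghost p =1 id -> injective (vmap p) ->
  (forall u, deco y (vmap p u) = deco x u) -> modular_mor p.
Proof.
move=> gp vi gE; apply/modular_morE; split=> [u u' /vi -> //|v].
have [u <-] := vmap_surj p v.
have e : vfiber p (vmap p u) =1 pred1 u by move=> u'; rewrite /vfiber (inj_eq vi).
rewrite !(eq_bigl _ _ e) !big_pred1_eq gE [X in _ = (_ + X + _)%N]big_pred0.
  lia.
by move=> f; rewrite /half_edges gp eqxx.
Qed.

Lemma modular_comp (x y z : genus_agg) (q : hom y z) (p : hom x y) :
  modular_mor q -> modular_mor p -> modular_mor (q ∘ p).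
Proof.
move=> /modular_morE[qc qg] /modular_morE[pc pg]; apply/modular_morE; split.
  move=> u u' /= /qc /connectP[s]; elim: s u => [|v s IH] u /=.
    move=> _ /esym/pc; apply: connect_sub => {u'}u u'.
    case/existsP => f /and3P[fp fu fu'].
    apply: connect1; apply/existsP; exists f.
    by rewrite /= comp_ghost_out ?fp ?fu // -ghost_fix.
  case/andP => /existsP[g /and3P[gq /eqP gu /eqP gv]] sp sl.
  have h : ghost_adj (agg_comp q p) (bdry (fmap p g)) (bdry (fmap p (ghost q g))).
    apply/existsP; exists (fmap p g).
    by rewrite /= comp_ghost_in (inj_eq (@fmap_inj _ _ p)) gq !eqxx.
  apply: connect_trans (IH (bdry (fmap p (ghost q g))) _ _); last 2 first.
  - by rewrite bdry_fmap gv.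
  - by rewrite bdry_fmap gv.
  apply: connect_trans (connect1 h).
  have /pc : vmap p u = vmap p (bdry (fmap p g)) by rewrite bdry_fmap gu.
  apply: connect_sub => {h}w w' /existsP[f /and3P[fp fu fu']].
  apply: connect1; apply/existsP; exists f.
  by rewrite /= comp_ghost_out ?fp ?fu // -ghost_fix.
move=> w.
have part (F : vert (dob x) -> nat) :
    (\sum_(u | vfiber (q ∘ p : agg_hom _ _) w u) F u =
     \sum_(v | vfiber q w v) \sum_(u | vfiber p v u) F u)%N.
  rewrite (partition_big (vmap p) (vfiber q w)) //=; apply: eq_bigr => v vw.
  apply: eq_bigl => u; rewrite /vfiber /=.
  by case: (vmap p u =P v) => [->|]; rewrite ?andbF // (eqP vw) eqxx.
have flags : (\sum_(f | half_edges (q ∘ p : agg_hom _ _) w f) 1 =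
     \sum_(g | half_edges q w g) 1 +
     \sum_(v | vfiber q w v) \sum_(f | half_edges p v f) 1)%N.
  rewrite (bigID (fun f => f \in codom (fmap p))) /=; congr addn.
    rewrite !sum1dep_card -(card_imset _ (@fmap_inj _ _ p)); congr #|pred_of_set _|.
    apply/setP => f; rewrite inE; apply/andP/imsetP => [[fw /codomP[g fE]]|].
      exists g => //; move: fw; rewrite fE inE /half_edges /= comp_ghost_in.
      by rewrite (inj_eq (@fmap_inj _ _ p)) bdry_fmap.
    case=> g; rewrite inE => gw ->; split; last exact: codom_f.
    by move: gw; rewrite /half_edges /= comp_ghost_in (inj_eq (@fmap_inj _ _ p)) bdry_fmap.
  rewrite (partition_big (fun f => vmap p (bdry f)) (vfiber q w)) /=.
    apply: eq_bigr => v vw; apply: eq_bigl => f; rewrite /half_edges /=.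
    case: (agg_flagP p f) => [g|{}f fp].
      by rewrite codom_f ghost_fmap eqxx andbF.
    rewrite fp comp_ghost_out // andbT -andbA; congr andb.
    by case: (vmap p (bdry f) =P v) => [->|]; rewrite ?andbF // (eqP vw) eqxx.
  by move=> f /andP[/andP[_ fw] _].
have := qg w; rewrite flags !part.
have sum2 (F : vert (dob y) -> nat) :
    (\sum_(v | vfiber q w v) 2 * F v = 2 * \sum_(v | vfiber q w v) F v)%N.
  by rewrite big_distrr.
have : (\sum_(v | vfiber q w v) 2 * (deco y v + \sum_(u | vfiber p v u) 1) =
    \sum_(v | vfiber q w v) (2 * (\sum_(u | vfiber p v u) deco x u) +
      \sum_(f | half_edges p v f) 1 + 2 * 1))%N.
  by apply: eq_bigr => v _; apply: pg.
rewrite sum2 !big_split /= !sum2 big1_eq.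
move: (\sum_(i | vfiber q w i) deco y i)%N (\sum_(i | vfiber q w i) 1)%N => A B.
move: (\sum_(i | vfiber q w i) \sum_(u | vfiber p i u) 1)%N => C0.
move: (\sum_(i | vfiber q w i) \sum_(u | vfiber p i u) deco x u)%N => D0.
move: (\sum_(i | vfiber q w i) \sum_(f | half_edges p i f) 1)%N => E0.
move: (\sum_(g | half_edges q w g) 1)%N => F0.
lia.
Qed.

Lemma modular_tens (x x' y y' : genus_agg) (p : hom x x') (q : hom y y') :
  modular_mor p -> modular_mor q -> modular_mor (p ⊗ₕ q).
Proof.
move=> /modular_morE[pc pg] /modular_morE[qc qg]; apply/modular_morE; split.
  move=> [u|u] [u'|u'] //= [].
    move/pc/connectP => [s sp ->]; apply/connectP.
    exists (map inl s); last by rewrite last_map.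
    rewrite path_map; apply: sub_path sp => a b /existsP[f fE].
    by apply/existsP; exists (inl f).
  move/qc/connectP => [s sp ->]; apply/connectP.
  exists (map inr s); last by rewrite last_map.
  rewrite path_map; apply: sub_path sp => a b /existsP[f fE].
  by apply/existsP; exists (inr f).
have zl (I : finType) (F : I -> nat) : (\sum_(i | false) F i = 0)%N.
  exact: big_pred0.
case=> v; rewrite !big_sumType /=.
  have e1 i : vfiber (agg_tensm p q) (inl v) (inl i) = vfiber p v i.
    exact: (inj_eq inl_inj).
  have e2 i : half_edges (agg_tensm p q) (inl v) (inl i) = half_edges p v i.
    by rewrite /half_edges /= !(inj_eq inl_inj).
  have e3 i : vfiber (agg_tensm p q) (inl v) (inr i) = false by [].
  have e4 i : half_edges (agg_tensm p q) (inl v) (inr i) = false.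
    by rewrite /half_edges andbF.
  rewrite !(eq_bigl _ _ e1) !(eq_bigl _ _ e2) !(eq_bigl _ _ e3).
  rewrite !(eq_bigl _ _ e4) !zl !addn0; exact: pg.
have e1 i : vfiber (agg_tensm p q) (inr v) (inr i) = vfiber q v i.
  exact: (inj_eq inr_inj).
have e2 i : half_edges (agg_tensm p q) (inr v) (inr i) = half_edges q v i.
  by rewrite /half_edges /= !(inj_eq inr_inj).
have e3 i : vfiber (agg_tensm p q) (inr v) (inl i) = false by [].
have e4 i : half_edges (agg_tensm p q) (inr v) (inl i) = false.
  by rewrite /half_edges andbF.
rewrite !(eq_bigl _ _ e1) !(eq_bigl _ _ e2) !(eq_bigl _ _ e3).
rewrite !(eq_bigl _ _ e4) !zl !add0n; exact: qg.
Qed.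

Lemma modular_wide : wide_closed modular_mor.
Proof.
split=> [x|||x y z|x y z|x|x|x|x|x y].
2: exact: modular_comp.
2: exact: modular_tens.
all: apply: modular_relabel => //=.
- exact: can_inj (@sumAK _ _ _).
- by case=> [[]|].
- exact: can_inj (@sumAVK _ _ _).
- by case=> [|[]].
- exact: can_inj (@sumlK _).
- by case.
- exact: inr_inj.
- exact: can_inj (@sumrK _).
- by case=> [|[]].
- exact: inl_inj.
- exact: can_inj (@sumCK _ _).
- by case.
Qed.

Definition modular : smc := wide_smc modular_wide.

(* true marks the out-flags, false the in-flags. *)
Definition dir_agg0 : smc := @decorate agg_smc (fun a => flag a -> bool)
  (fun a b d e f => match f with inl u => d u | inr v => e v end)
  (fun f : void => match f with end).

Definition dir_mor (x y : dir_agg0) (p : hom x y) : Prop :=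
  (forall g, deco x (fmap p g) = deco y g) /\
  (forall f, ghost p f != f -> deco x (ghost p f) = ~~ deco x f).

Lemma dir_relabel (x y : dir_agg0) (p : hom x y) :
  ghost p =1 id -> (forall g, deco x (fmap p g) = deco y g) -> dir_mor p.
Proof. by move=> gp h; split=> // f; rewrite gp eqxx. Qed.

Lemma dir_wide : wide_closed dir_mor.
Proof.
split=> [x|x y z q p [q1 q2] [p1 p2]|x x' y y' p q [p1 p2] [q1 q2]
        |x y z|x y z|x|x|x|x|x y].
- exact: dir_relabel.
- split=> [g|f] /=; first by rewrite p1 q1.
  case: (agg_flagP p f) => [g|{}f fp].
    by rewrite comp_ghost_in (inj_eq (@fmap_inj _ _ p)) !p1; apply: q2.
  by rewrite comp_ghost_out //; apply: p2.
- split=> [[g|g]|[f|f]] /=; first exact: p1.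
  + exact: q1.
  + by rewrite (inj_eq inl_inj); apply: p2.
  + by rewrite (inj_eq inr_inj); apply: q2.
- by apply: dir_relabel => // -[|[]].
- by apply: dir_relabel => // -[[]|].
- exact: dir_relabel.
- by apply: dir_relabel => // -[].
- exact: dir_relabel.
- by apply: dir_relabel => // -[|[]].
- by apply: dir_relabel => // -[].
Qed.

Definition dir_agg : smc := wide_smc dir_wide.

Definition agg_of (x : dir_agg) : agg := und_ob (wide_ob x).
Definition is_out (x : dir_agg) : flag (agg_of x) -> bool :=
  structure (wide_ob x).
Definition mor_of (x y : dir_agg) (p : hom x y) : agg_hom (agg_of x) (agg_of y)
  := und_mor (wide_mor p).
Definition mor_of2 (x1 x2 y : dir_agg) (p : hom (x1 ⊗ x2) y) :
  agg_hom (agg_tens (agg_of x1) (agg_of x2)) (agg_of y) := mor_of p.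

Definition corolla (x : dir_agg) : Prop := #|vert (agg_of x)| = 1%N.

Definition merger (x y : dir_agg) (p : hom x y) : Prop :=
  corolla y /\ forall f, ghost (mor_of p) f = f.

(* The flags of x1 ⊗ x2 are inl f for f in x1 and inr g for g in x2. *)
Definition two_level (x1 x2 y : dir_agg) (p : hom (x1 ⊗ x2) y) : Prop :=
  let i := ghost (mor_of2 p) in
  [/\ corolla y,
      forall f, is_out f -> exists2 g, ~~ is_out g & i (inl f) = inr g,
      forall g, ~~ is_out g -> exists2 f, is_out f & i (inr g) = inl f,
      forall f, ~~ is_out f -> i (inl f) = inl f
    & forall g, is_out g -> i (inr g) = inr g].

Inductive prop_mor : forall x y : dir_agg, hom x y -> Prop :=
| pm_eqv x y (p q : hom x y) : p ≈ q -> prop_mor p -> prop_mor q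
| pm_iso x y (s : iso x y) : prop_mor (fwd s)
| pm_merger x y (p : hom x y) : merger p -> prop_mor p
| pm_two_level x1 x2 y (p : hom (x1 ⊗ x2) y) : two_level p -> prop_mor p
| pm_comp x y z (q : hom y z) (p : hom x y) :
    prop_mor q -> prop_mor p -> prop_mor (q ∘ p)
| pm_tens x x' y y' (p : hom x x') (q : hom y y') :
    prop_mor p -> prop_mor q -> prop_mor (p ⊗ₕ q).

Lemma prop_wide : wide_closed prop_mor.
Proof.
split.
- by move=> x; apply: (pm_iso (iso_id x)).
- exact: pm_comp.
- exact: pm_tens.
- by move=> x y z; apply: (pm_iso (assoc x y z)).
- by move=> x y z; apply: (pm_iso (iso_inv (assoc x y z))).
- by move=> x; apply: (pm_iso (lunit x)).
- by move=> x; apply: (pm_iso (iso_inv (lunit x))).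
- by move=> x; apply: (pm_iso (runit x)).
- by move=> x; apply: (pm_iso (iso_inv (runit x))).
- by move=> x y; apply: (pm_iso (iso_braid x y)).
Qed.

Definition prop_base : smc := wide_smc prop_wide.

(* The corolla with one in-flag and one out-flag. *)
Definition star11 : prop_base :=
  @DObj agg_smc (fun a => flag a -> bool) (@Agg unit bool (fun=> tt)) id.

Inductive prop_gen : prop_base -> prop_base -> Type :=
| Punit : prop_gen unit_ob star11.

Notation prin := (ain prop_gen).

Fixpoint stars (n : nat) : prop_base :=
  if n is m.+1 then star11 ⊗ stars m else unit_ob.

Fixpoint units (n : nat) : aterm prop_gen unit_ob (stars n) :=
  match n with
  | 0 => prin (idm unit_ob)
  | m.+1 => acomp (atens (agen prop_gen Punit) (units m))
                  (prin (bwd (lunit unit_ob)))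
  end.

(* Let t be a two-level contraction of x with a sum s of copies of star11, after
   x or before x.  In the merger m of x, each flag of x that t glues to a copy
   of star11 takes the place of the other flag of that copy. *)
Definition absorb_right (x s y : dir_agg) (t : hom (x ⊗ s) y) (m : hom x y) :
    Prop :=
  [/\ two_level t, merger m,
      forall (h : flag (agg_of y)) (f : flag (agg_of x)),
        fmap (mor_of2 t) h = inl f -> fmap (mor_of m) h = f
    & forall (h : flag (agg_of y)) (g g' : flag (agg_of s)),
        fmap (mor_of2 t) h = inr g -> bdry g' = bdry g -> g' <> g ->
        ghost (mor_of2 t) (inr g') = inl (fmap (mor_of m) h)].

Definition absorb_left (x s y : dir_agg) (t : hom (s ⊗ x) y) (m : hom x y) :
    Prop :=
  [/\ two_level t, merger m,
      forall (h : flag (agg_of y)) (f : flag (agg_of x)),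
        fmap (mor_of2 t) h = inr f -> fmap (mor_of m) h = f
    & forall (h : flag (agg_of y)) (g g' : flag (agg_of s)),
        fmap (mor_of2 t) h = inl g -> bdry g' = bdry g -> g' <> g ->
        ghost (mor_of2 t) (inl g') = inr (fmap (mor_of m) h)].

Definition base_ob (x : prop_base) : dir_agg := wide_ob x.
Definition base_mor (x y : prop_base) (p : hom x y) :
  hom (base_ob x) (base_ob y) := wide_mor p.
Definition base_mor2 (x1 x2 y : prop_base) (p : hom (x1 ⊗ x2) y) :
  hom (base_ob x1 ⊗ base_ob x2) (base_ob y) := wide_mor p.

Inductive prop_rel : forall x y : prop_base,
    aterm prop_gen x y -> aterm prop_gen x y -> Prop :=
| prop_unitr n (x y : prop_base) (t : hom (x ⊗ stars n) y) (m : hom x y) :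
    absorb_right (base_mor2 t) (base_mor m) ->
    prop_rel (acomp (prin t) (atens (prin (idm x)) (units n)))
             (prin (m ∘ runit x))
| prop_unitl n (x y : prop_base) (t : hom (stars n ⊗ x) y) (m : hom x y) :
    absorb_left (base_mor2 t) (base_mor m) ->
    prop_rel (acomp (prin t) (atens (units n) (prin (idm x))))
             (prin (m ∘ lunit x)).

Definition props : smc := adjoin prop_rel.

(* Main.v *)
From Stdlib Require Import Setoid.
From mathcomp Require Import all_boot.
Require Import Defs.

(** A plus construction has few isomorphisms.  Each defining relation of [plus M]
    has a generator gamma on both sides or on neither, so having a gamma is an
    invariant of morphisms.  As it is inherited by composites, an isomorphism has
    no gamma and comes from an isomorphism of arrows of [M]
    ([left_inverse_free], [plus_iso_down]).

    The source of a morphism with a gamma is isomorphic to some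
    (f1 ⊗ f0) ⊗ h, where f1 and f0 are composable ([gamma_source]).  If f1 is
    isomorphic to the unit, then f1 is an isomorphism of [M], so that f1 ∘ f0,
    f0 and f1 ⊗ f0 are isomorphic objects; the same holds if f0 is isomorphic
    to the unit ([gamma_unit_target]).  In either case gamma ⊗ id is, up to
    isomorphism, an endomorphism of the source, and having a gamma it has no left
    inverse.

    So a symmetric monoidal category C is not equivalent to any [plus M] if it has
    an object x whose endomorphisms are left invertible, such that in
    (a ⊗ b) ⊗ c ≅ x always a or b is a unit, together with a morphism x -> y
    that has no morphism back ([plus_obstruction]): the image of x -> y has a
    gamma, whence an endomorphism of the image of x that cannot exist.

    - For modular operads, x is the corolla of genus 0 with two flags, and x -> y
      contracts its loop.  Indecomposability holds because x has a single vertex.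
    - For the nc version, x -> y is the same loop contraction between words of
      length one.  Collapsing a word to the product of its letters shows that all
      morphisms between such words come from modular operads ([nc_leaf_full]),
      and counting letters shows that x is indecomposable.
    - For props, x is the empty aggregate and x -> y is the unit u.  No morphism
      goes from a nonempty aggregate to the empty one, so u does not occur in an
      endomorphism of x.
*)

Set Implicit Arguments.
Unset Strict Implicit.
Unset Printing Implicit Defensive.

Local Open Scope cat_scope.

Notation "x ≅ y" := (inhabited (iso x y)) (at level 70, no associativity).

(** * Morphisms without generators *)

Section Adjoin.
Variables (C : smc) (G : C -> C -> Type).

Fixpoint generator_free x y (t : aterm G x y) : bool :=
  match t with
  | ain _ _ _ => true
  | agen _ _ _ => false
  | acomp _ _ _ s t => generator_free s && generator_free t
  | atens _ _ _ _ s t => generator_free s && generator_free t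
  end.

Variable R : forall x y, aterm G x y -> aterm G x y -> Prop.

Lemma generator_free_ain x y (t : aterm G x y) :
  generator_free t -> exists f : hom x y, aeq (@R) t (ain G f).
Proof.
elim: t => [{}x {}y f|//|{}x {}y z s IHs t IHt|{}x x' {}y y' s IHs t IHt] /=.
- by exists f; apply: aeq_refl.
- case/andP=> /IHs[f ef] /IHt[g eg]; exists (f ∘ g).
  exact: aeq_trans (aeq_comp ef eg) (aeq_sym (aeq_in_comp _ _ _)).
- case/andP=> /IHs[f ef] /IHt[g eg]; exists (f ⊗ₕ g).
  exact: aeq_trans (aeq_tens ef eg) (aeq_sym (aeq_in_tens _ _ _)).
Qed.

Hypothesis R_free : forall x y (s t : aterm G x y),
  R s t -> generator_free s = generator_free t.

(** The structural relations only regroup morphisms and move them past structure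
    maps, so only the relations R have to be checked. *)
Lemma aeq_generator_free x y (s t : aterm G x y) :
  aeq (@R) s t -> generator_free s = generator_free t.
Proof.
elim=> //=; try by [exact: R_free|move=> *; congruence]; move=> *;
  by do ![case: generator_free].
Qed.

(** Generators never cancel in a composite. *)
Lemma left_inverse_free x y (s : @hom (adjoin R) y x) (t : @hom (adjoin R) x y) :
  s ∘ t ≈ idm x -> generator_free t.
Proof. by move/aeq_generator_free => /= /andP[]. Qed.

End Adjoin.

(** * Generators of the plus construction *)

Section Plus.
Variable M : smc.

Lemma plus_rel_free (f g : arr_smc M) (s t : aterm (@plus_gen M) f g) :
  plus_rel s t -> generator_free s = generator_free t.
Proof. by case. Qed.

Definition plus_iso (f g : arr_smc M) (d : down f g) : @iso (plus M) f g :=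
  @adjoin_iso (arr_smc M) _ (@plus_rel M) f g (arr_iso d).

Lemma plus_iso_down (f g : plus M) : f ≅ g -> inhabited (@down M f g).
Proof.
case=> i; have [d _] := generator_free_ain (@plus_rel M)
  (left_inverse_free plus_rel_free (bwdK i)).
by constructor; exact: d.
Qed.

(** The source of the gamma performed first survives: everything before it is an
    isomorphism, and everything beside it goes into h. *)
Lemma gamma_source (f g : arr_smc M) (t : aterm (@plus_gen M) f g) :
  ~~ generator_free t -> exists x y z (f1 : hom y z) (f0 : hom x y) (h : plus M),
    (f : plus M) ≅ ((arr f1 : plus M) ⊗ (arr f0 : plus M)) ⊗ h.
Proof.
elim: t => {f g} [//|f g [x y z f1 f0] _|f g h s IHs t IHt|f f' g g' s IHs t IHt] /=.
- exists x, y, z, f1, f0, (@unit_ob (plus M)); constructor.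
  exact: (iso_inv (@runit (plus M) ((arr f1 : plus M) ⊗ (arr f0 : plus M)))).
- rewrite negb_and; case: (boolP (generator_free t)) => [tf|tf _]; last exact: IHt.
  rewrite orbF => /IHs[x [y [z [f1 [f0 [k [i]]]]]]].
  case/(generator_free_ain (@plus_rel M)): tf => d _.
  exists x, y, z, f1, f0, k; constructor.
  exact: (iso_comp i (plus_iso d)).
- rewrite negb_and => /orP[/IHs|/IHt] [x [y [z [f1 [f0 [k [i]]]]]]].
  + exists x, y, z, f1, f0, (k ⊗ (g : plus M)); constructor.
    exact: iso_comp (assoc _ _ _) (iso_tens i (iso_id _)).
  + exists x, y, z, f1, f0, (k ⊗ (f : plus M)); constructor.
    apply: iso_comp (assoc _ _ _) (iso_comp (iso_tens i (iso_id _)) _).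
    exact: iso_braid.
Qed.

(** An isomorphism from f to the unit is a commuting square from f to an identity,
    whose other two sides are isomorphisms. *)
Lemma down_unit_iso (x y : M) (f : hom x y) :
  (arr f : plus M) ≅ unit_ob -> exists s : iso x y, f ≈ s.
Proof.
case/plus_iso_down=> d; have /= e := down_sq d; rewrite comp1m in e.
exists (iso_comp (iso_inv (dtgt d)) (dsrc d)).
by rewrite /= e compA bwdK comp1m.
Qed.

(** Composing with an isomorphism s does not change the isomorphism class of an
    arrow, and tensoring with a unit does not either.  This makes gamma an
    endomorphism up to isomorphism. *)
Lemma gamma_unit_target (x y z : M) (f1 : hom y z) (f0 : hom x y) :
  (arr f1 : plus M) ≅ unit_ob \/ (arr f0 : plus M) ≅ unit_ob ->
  (arr f1 : plus M) ⊗ (arr f0 : plus M) ≅ (arr (f1 ∘ f0) : plus M).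
Proof.
case=> u; have [s e] := down_unit_iso u; case: u => u; constructor.
- apply: iso_comp (iso_comp (lunit _) (iso_tens u (iso_id _))).
  apply: plus_iso; apply: (@mk_down M (arr f0) (arr (f1 ∘ f0)) (iso_id x) s).
  by rewrite /= compm1 e.
- apply: iso_comp (iso_comp (runit _) (iso_tens (iso_id _) u)).
  apply: plus_iso; apply: down_inv.
  apply: (@mk_down M (arr (f1 ∘ f0)) (arr f1) s (iso_id z)).
  by rewrite /= comp1m e.
Qed.

End Plus.

(** * The obstruction *)

Definition functor_iso (C D : category) (F : functor C D) (x y : C)
  (i : iso x y) : iso (F x) (F y).
Proof.
by apply: (@Iso D _ _ (fhom F i) (fhom F (bwd i)));
  rewrite -fhom_comp -fhom1; apply: fhom_cong; [apply: bwdK|apply: fwdK].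
Defined.

Definition endo_left_invertible (C : category) (x : C) : Prop :=
  forall e : hom x x, exists h : hom x x, h ∘ e ≈ idm x.

Lemma endo_left_invertible_iso (C : category) (x y : C) :
  x ≅ y -> endo_left_invertible x -> endo_left_invertible y.
Proof.
case=> i xP e; have [h he] := xP (bwd i ∘ e ∘ i); exists (i ∘ h ∘ bwd i).
have <- : i ∘ (h ∘ (bwd i ∘ e ∘ i)) ∘ bwd i ≈ i ∘ h ∘ bwd i ∘ e.
  by rewrite !compA -[X in X ≈ _]compA fwdK compm1.
by rewrite he compm1 fwdK.
Qed.

(** Up to the isomorphism n an endomorphism e of x is F (G e), and F sends a left
    inverse of G e to one of F (G e). *)
Lemma endo_left_invertible_functor (C D : category) (F : functor C D)
    (G : functor D C) (n : nat_iso (functor_comp F G) (functor_id D)) (x : D) :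
  endo_left_invertible (G x) -> endo_left_invertible x.
Proof.
move=> xP e; have [h he] := xP (fhom G e); exists (n x ∘ fhom F h ∘ bwd (n x)).
have eE : e ≈ n x ∘ fhom F (fhom G e) ∘ bwd (n x).
  by have /= -> := nt_nat n e; rewrite -compA fwdK compm1.
rewrite {1}eE !compA -(compA _ (bwd (n x)) (n x)) bwdK compm1.
rewrite -(compA (n x) (fhom F h)) -fhom_comp.
by rewrite (fhom_cong F he) fhom1 compm1 fwdK.
Qed.

(** Since y has no morphism to x, the image of x -> y is not an isomorphism and so
    has a gamma.  The decomposition of its source transports back to C, where one
    of the two factors of gamma is seen to be a unit. *)
Theorem plus_obstruction (C M : smc) (x y : C) :
  endo_left_invertible x ->
  (forall a b c : C, (a ⊗ b) ⊗ c ≅ x -> a ≅ unit_ob \/ b ≅ unit_ob) ->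
  hom x y -> (hom y x -> False) ->
  ~ sm_equivalent C (plus M).
Proof.
move=> xP xI p np [F [G [[m] [n]]]].
case: (boolP (generator_free (fhom F p))) => [|/gamma_source].
  case/(generator_free_ain (@plus_rel M)) => d _; apply: np.
  exact: comp (m x) (comp (fhom G (bwd (plus_iso d))) (bwd (m y))).
case=> [u [v [w [f1 [f0 [h [i]]]]]]].
have unitP (z : plus M) : G z ≅ unit_ob -> z ≅ unit_ob.
  case=> j; constructor.
  exact: iso_comp (iso_inv (seps F)) (iso_comp (functor_iso F j) (iso_inv (n z))).
have decomposition : (G (arr f1) ⊗ G (arr f0)) ⊗ G h ≅ x.
  constructor; apply: iso_comp (m x) _; apply: iso_comp (iso_inv (m _)) => /=.
  apply: (functor_iso G); apply: iso_comp (iso_inv i) _.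
  apply: iso_comp (iso_inv (smu F _ _)).
  apply: iso_tens (n h); apply: iso_comp (iso_inv (smu F _ _)).
  exact: iso_tens (n _) (n _).
have [j] : (arr f1 : plus M) ⊗ (arr f0 : plus M) ≅ (arr (f1 ∘ f0) : plus M).
  by apply: gamma_unit_target; case/xI: decomposition => /unitP; [left|right].
have FxP : endo_left_invertible (F x).
  apply: (endo_left_invertible_functor n).
  by apply: endo_left_invertible_iso xP; constructor; exact: iso_inv (m x).
(* Up to i and j this is gamma ⊗ id, an endomorphism of F x with a gamma. *)
pose g : @hom (plus M) _ _ := agen (@plus_gen M) (Gamma f1 f0).
have [k] := FxP (bwd i ∘ (bwd j ⊗ₕ idm h) ∘ (g ⊗ₕ idm h) ∘ i).
by move/(left_inverse_free (@plus_rel_free M)) => /=; rewrite !(andbF, andFb).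
Qed.

(** The reason why objects with exactly one letter or one vertex are
    indecomposable: u and v below would be two points of the sum, which injects
    into the singleton U. *)
Lemma retract_singleton_empty (A B C U : Type) (f : A + B + C -> U)
    (g : U -> A + B + C) :
  cancel f g -> (forall u v : U, u = v) -> U -> (A -> False) \/ (B -> False).
Proof.
move=> fK Us u0.
have sE (x y : A + B + C) : x = y by rewrite -(fK x) -(fK y) (Us (f x) (f y)).
case: (g u0) => [[u|v]|w].
- by right=> v; have := sE (inl (inl u)) (inl (inr v)).
- by left=> u; have := sE (inl (inl u)) (inl (inr v)).
- by left=> u; have := sE (inl (inl u)) (inr w).
Qed.

(** * The nc version *)

Section NC.
Variable F : smc.
Notation N := (nc F).
Notation lf x := (leaf x : N).

Definition leaf_mor (x y : F) (f : hom x y) : @hom N (lf x) (lf y) :=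
  ain (@nc_gen F) (leafm f).
Definition nc_mu (x y : F) : @hom N (lf x ⊗ lf y) (lf (x ⊗ y)) :=
  agen (@nc_gen F) (Mu x y).
Definition nc_eps : @hom N unit_ob (lf unit_ob) := agen (@nc_gen F) (Eps F).

Lemma leaf_mor1 (x : F) : leaf_mor (idm x) ≈ idm (lf x).
Proof. by apply: aeq_in; apply: feq_in1. Qed.

Lemma leaf_mor_comp (x y z : F) (g : hom y z) (f : hom x y) :
  leaf_mor (g ∘ f) ≈ leaf_mor g ∘ leaf_mor f.
Proof.
by apply: aeq_trans (aeq_in_comp _ _ _); apply: aeq_in; apply: feq_in_comp.
Qed.

Definition leaf_iso (x y : F) (s : iso x y) : iso (lf x) (lf y).
Proof.
apply: (@Iso N (lf x) (lf y) (leaf_mor s) (leaf_mor (bwd s)));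
  rewrite -leaf_mor_comp -leaf_mor1; apply: aeq_in; apply: feq_in.
- exact: bwdK.
- exact: fwdK.
Defined.

Fixpoint total (w : word F) : F :=
  match w with
  | Wleaf x => x
  | Wone => unit_ob
  | Wtens a b => total a ⊗ total b
  end.

Fixpoint collapse (w : word F) : @hom N w (lf (total w)) :=
  match w return @hom N w (lf (total w)) with
  | Wleaf x => idm (lf x)
  | Wone => nc_eps
  | Wtens a b => nc_mu (total a) (total b) ∘ (collapse a ⊗ₕ collapse b)
  end.

Lemma collapse_tens (a b : N) : collapse (a ⊗ b) ≈
  nc_mu (total a) (total b) ∘ (collapse a ⊗ₕ collapse b).
Proof. by []. Qed.

Lemma collapse_leaf (x : F) : collapse (lf x) ≈ idm (lf x).
Proof. by []. Qed.

(** Naturality of [collapse] at t, for some f in place of the image of t under the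
    functor that multiplies words out. *)
Definition collapsible (a b : N) (t : hom a b) : Prop :=
  exists f : hom (total a) (total b), collapse b ∘ t ≈ leaf_mor f ∘ collapse a.

Lemma collapsible_heq (a b : N) (s t : hom a b) :
  s ≈ t -> collapsible s -> collapsible t.
Proof. by move=> e [f fE]; exists f; rewrite -e. Qed.

Lemma collapsible_id (a : N) : collapsible (idm a).
Proof. by exists (idm (total a)); rewrite compm1 leaf_mor1 comp1m. Qed.

Lemma collapsible_comp (a b c : N) (s : hom b c) (t : hom a b) :
  collapsible s -> collapsible t -> collapsible (s ∘ t).
Proof.
move=> [f fE] [g gE]; exists (f ∘ g).
by rewrite compA fE -compA gE compA leaf_mor_comp.
Qed.

Lemma nc_mu_nat (x x' y y' : F) (f : hom x x') (g : hom y y') :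
  leaf_mor (f ⊗ₕ g) ∘ nc_mu x y ≈ nc_mu x' y' ∘ (leaf_mor f ⊗ₕ leaf_mor g).
Proof. exact: aeq_rel (nc_nat f g). Qed.

Lemma collapsible_tens (a a' b b' : N) (s : hom a a') (t : hom b b') :
  collapsible s -> collapsible t -> collapsible (s ⊗ₕ t).
Proof.
move=> [f fE] [g gE]; exists (f ⊗ₕ g).
by rewrite !collapse_tens -compA -tensm_comp fE gE tensm_comp !compA nc_mu_nat.
Qed.

Lemma collapsible_bwd (a b : N) (s : iso a b) (i : iso (total a) (total b)) :
  collapse b ∘ s ≈ leaf_mor i ∘ collapse a -> collapsible (bwd s).
Proof.
move=> e; exists (bwd i).
have: leaf_mor (bwd i) ∘ (collapse b ∘ s) ∘ bwd s ≈
      leaf_mor (bwd i) ∘ (leaf_mor i ∘ collapse a) ∘ bwd s by rewrite e.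
rewrite (compA _ (leaf_mor i)) (bwdK (leaf_iso i)) comp1m => <-.
by rewrite -!compA fwdK compm1.
Qed.

(** The coherence axiom of the lax structure holds between letters, and naturality
    of the structure maps extends it to words; likewise for the units and the
    braiding. *)
Lemma collapse_assoc (a b c : N) :
  collapse (a ⊗ (b ⊗ c)) ∘ assoc a b c ≈
  leaf_mor (assoc (total a) (total b) (total c)) ∘ collapse ((a ⊗ b) ⊗ c).
Proof.
have e : leaf_mor (assoc (total a) (total b) (total c)) ∘
    (nc_mu (total a ⊗ total b) (total c) ∘ (nc_mu (total a) (total b) ⊗ₕ idm _))
    ≈ nc_mu (total a) (total b ⊗ total c) ∘
       ((idm _ ⊗ₕ nc_mu (total b) (total c)) ∘ assoc (lf _) (lf _) (lf _)).
  exact: aeq_rel (nc_assoc (total a) (total b) (total c)).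
have -> : collapse ((a ⊗ b) ⊗ c) ≈
    nc_mu (total a ⊗ total b) (total c) ∘ (nc_mu (total a) (total b) ⊗ₕ idm _) ∘
    ((collapse a ⊗ₕ collapse b) ⊗ₕ collapse c).
  by rewrite !collapse_tens -compA -tensm_comp comp1m.
rewrite (@compA N _ _ _ _ (leaf_mor _)) e -!compA assoc_nat !compA.
by rewrite -(compA (nc_mu _ _)) -tensm_comp comp1m.
Qed.

Lemma collapse_lunit (a : N) :
  collapse a ∘ lunit a ≈ leaf_mor (lunit (total a)) ∘ collapse (unit_ob ⊗ a).
Proof.
have e : leaf_mor (lunit (total a)) ∘
    (nc_mu unit_ob (total a) ∘ (nc_eps ⊗ₕ idm _)) ≈ lunit (lf (total a)).
  exact: aeq_rel (nc_lunit (total a)).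
have -> : collapse (unit_ob ⊗ a) ≈
    nc_mu unit_ob (total a) ∘ (nc_eps ⊗ₕ idm _) ∘ (idm unit_ob ⊗ₕ collapse a).
  by rewrite collapse_tens -compA -tensm_comp comp1m compm1.
by rewrite (@compA N _ _ _ _ (leaf_mor _)) e lunit_nat.
Qed.

Lemma collapse_runit (a : N) :
  collapse a ∘ runit a ≈ leaf_mor (runit (total a)) ∘ collapse (a ⊗ unit_ob).
Proof.
have e : leaf_mor (runit (total a)) ∘
    (nc_mu (total a) unit_ob ∘ (idm _ ⊗ₕ nc_eps)) ≈ runit (lf (total a)).
  exact: aeq_rel (nc_runit (total a)).
have -> : collapse (a ⊗ unit_ob) ≈
    nc_mu (total a) unit_ob ∘ (idm _ ⊗ₕ nc_eps) ∘ (collapse a ⊗ₕ idm unit_ob).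
  by rewrite collapse_tens -compA -tensm_comp comp1m compm1.
by rewrite (@compA N _ _ _ _ (leaf_mor _)) e runit_nat.
Qed.

Lemma collapse_braid (a b : N) :
  collapse (b ⊗ a) ∘ braid a b ≈
  leaf_mor (braid (total a) (total b)) ∘ collapse (a ⊗ b).
Proof.
have e : leaf_mor (braid (total a) (total b)) ∘ nc_mu (total a) (total b) ≈
    nc_mu (total b) (total a) ∘ braid (lf _) (lf _).
  exact: aeq_rel (nc_braid (total a) (total b)).
by rewrite !collapse_tens (@compA N _ _ _ _ (leaf_mor _)) e -!compA braid_nat compA.
Qed.

Lemma collapsible_free (a b : word F) (t : fterm a b) :
  @collapsible a b (ain (@nc_gen F) (t : @hom (free_smc F) a b)).
Proof.
elim: t => {a b} [x y f|a|a b c s IHs t IHt|a a' b b' s IHs t IHt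
                 |a b c|a b c|a|a|a|a|a b].
- exists f; change (idm (lf y) ∘ leaf_mor f ≈ leaf_mor f ∘ idm (lf x)).
  by rewrite compm1 comp1m.
- exact: collapsible_id.
- apply: collapsible_heq (collapsible_comp IHs IHt).
  exact: aeq_sym (aeq_in_comp _ _ _).
- apply: collapsible_heq (collapsible_tens IHs IHt).
  exact: aeq_sym (aeq_in_tens _ _ _).
- by eexists; apply: collapse_assoc.
- exact: collapsible_bwd (collapse_assoc a b c).
- by eexists; apply: collapse_lunit.
- exact: collapsible_bwd (collapse_lunit a).
- by eexists; apply: collapse_runit.
- exact: collapsible_bwd (collapse_runit a).
- by eexists; apply: collapse_braid.
Qed.

Lemma nc_collapsible (a b : N) (t : hom a b) : collapsible t.
Proof.
elim: t => {a b} [a b t|a b [x y|]|a b c s IHs t IHt|a a' b b' s IHs t IHt].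
- exact: collapsible_free.
- exists (idm (x ⊗ y)); change (idm (lf (x ⊗ y)) ∘ nc_mu x y ≈
    leaf_mor (idm (x ⊗ y)) ∘ (nc_mu x y ∘ (idm (lf x) ⊗ₕ idm (lf y)))).
  by rewrite leaf_mor1 !comp1m tensm1 compm1.
- exists (idm unit_ob); change (idm (lf unit_ob) ∘ nc_eps ≈ leaf_mor (idm unit_ob) ∘ nc_eps).
  by rewrite leaf_mor1.
- exact: collapsible_comp IHs IHt.
- exact: collapsible_tens IHs IHt.
Qed.

(** On a word of length one [collapse] is the identity, so naturality identifies t
    with a morphism coming from F. *)
Lemma nc_leaf_full (x y : F) (t : hom (lf x) (lf y)) :
  exists f : hom x y, t ≈ leaf_mor f.
Proof.
have [f e] := nc_collapsible t; exists f; move: e.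
by rewrite !collapse_leaf comp1m compm1.
Qed.

(** Sending every object of F to a singleton is a lax monoidal functor to sets with
    disjoint union, so it extends to the nc version: a morphism of words induces a
    map of their letters. *)
Fixpoint leaves (w : word F) : Type :=
  match w with
  | Wleaf _ => unit
  | Wone => void
  | Wtens a b => (leaves a + leaves b)%type
  end.

Fixpoint free_leaf_map a b (t : fterm a b) : leaves a -> leaves b :=
  match t with
  | fin _ _ _ => id
  | fid _ => id
  | fcomp _ _ _ s t => free_leaf_map s \o free_leaf_map t
  | ftens _ _ _ _ s t => sum_map (free_leaf_map s) (free_leaf_map t)
  | fassoc _ _ _ => @sumA _ _ _
  | fassocV _ _ _ => @sumAV _ _ _
  | flunit _ => @suml _
  | flunitV _ => inr
  | frunit _ => @sumr _
  | frunitV _ => inl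
  | fbraid _ _ => @sumC _ _
  end.

Definition nc_gen_leaf_map a b (g : nc_gen a b) : leaves a -> leaves b :=
  match g with
  | Mu _ _ => fun=> tt
  | Eps => fun=> tt
  end.

Fixpoint leaf_map a b (t : aterm (@nc_gen F) a b) : leaves a -> leaves b :=
  match t with
  | ain _ _ f => free_leaf_map f
  | agen _ _ g => nc_gen_leaf_map g
  | acomp _ _ _ s t => leaf_map s \o leaf_map t
  | atens _ _ _ _ s t => sum_map (leaf_map s) (leaf_map t)
  end.

Lemma free_leaf_map_eq a b (s t : fterm a b) :
  feq s t -> free_leaf_map s =1 free_leaf_map t.
Proof.
elim=> {a b s t} //=; try by move=> *; do ?case.
- by move=> a b s t u _ e1 _ e2 x; rewrite e1.
- by move=> a b c s s' t t' _ e1 _ e2 x /=; rewrite e2 e1.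
- by move=> a a' b b' s s' t t' _ e1 _ e2 [x|x] /=; rewrite ?e1 ?e2.
Qed.

Lemma leaf_map_eq (a b : N) (s t : hom a b) :
  s ≈ t -> leaf_map s =1 leaf_map t.
Proof.
elim=> {a b s t} //=; try by move=> *; do ?case.
- by move=> a b s t u _ e1 _ e2 x; rewrite e1.
- by move=> a b c s s' t t' _ e1 _ e2 x /=; rewrite e2 e1.
- by move=> a a' b b' s s' t t' _ e1 _ e2 [x|x] /=; rewrite ?e1 ?e2.
- by move=> a b f g; apply: free_leaf_map_eq.
- by move=> a b s t [] *; do ?case.
Qed.

Lemma leafless_unit (a : word F) : (leaves a -> False) -> (a : N) ≅ unit_ob.
Proof.
elim: a => [x|_|a IHa b IHb] /=.
- by case.
- by constructor; apply: (iso_id (unit_ob : N)).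
- move=> n; have [i] := IHa (n \o inl); have [j] := IHb (n \o inr).
  by constructor; apply: (iso_comp (lunit (unit_ob : N)) (iso_tens i j)).
Qed.

Lemma nc_leaf_indecomposable (x : F) (a b c : N) :
  (a ⊗ b) ⊗ c ≅ lf x -> a ≅ unit_ob \/ b ≅ unit_ob.
Proof.
case=> i.
have leafK : cancel (leaf_map (fwd i)) (leaf_map (bwd i)).
  by move=> u; apply: (leaf_map_eq (bwdK i) u).
have unit_eq (u v : leaves (leaf x)) : u = v by case: u; case: v.
have [n|n] := retract_singleton_empty leafK unit_eq tt.
- by left; apply: leafless_unit.
- by right; apply: leafless_unit.
Qed.

End NC.

(** * Modular operads *)

(** Every flag lies at a vertex, so an aggregate without vertices has no flags. *)
Definition vertexless_iso (a : agg) (n : vert a -> False) :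
  iso (a : agg_cat) agg_unit :=
  @relabel_iso a agg_unit (fun x => False_rect _ (n x)) (fun x => match x with end)
    (fun x => match x with end) (fun f => False_rect _ (n (bdry f)))
    (fun x => False_ind _ (n x)) (fun x => match x with end)
    (fun x => match x with end) (fun f => False_ind _ (n (bdry f)))
    (fun x => match x with end).

Definition decorated_vertexless_iso (D : agg_smc -> Type)
    (dt : forall x y, D x -> D y -> D (x ⊗ y)) (du : D unit_ob)
    (x : decorate dt du) (n : vert (dob x : agg) -> False) : iso x unit_ob :=
  @decorate_iso agg_smc D x (@unit_ob (decorate dt du)) (vertexless_iso n).

Definition node02 : modular :=
  @DObj agg_smc (fun a => vert a -> nat) (@Agg unit bool (fun=> tt)) (fun=> 0).
Definition node10 : modular :=
  @DObj agg_smc (fun a => vert a -> nat) (@Agg unit void (fun=> tt)) (fun=> 1).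

(** The involution [negb] joins the two flags of [node02] into the contracted loop,
    whose Betti number 1 is the genus of [node10]. *)
Definition loop_agg : agg_hom (dob node02) (dob node10).
Proof.
apply: (@AggHom (dob node02) (dob node10) id (fun x => match x with end) negb) => //.
- by case; exists tt.
- exact: negbK.
- by move=> f; apply/esym; case: f => /=; apply/negbTE/negP => /codomP[[]].
Defined.

Lemma loop_modular : @modular_mor node02 node10 loop_agg.
Proof.
apply/modular_morE; split=> [[] [] _|[]]; first exact: connect0.
have eE f : half_edges loop_agg tt f = true by case: f.
have vE u : vfiber loop_agg tt u = true by case: u.
rewrite (eq_bigl _ _ eE) !(eq_bigl _ _ vE).
by rewrite !sum1_card card_bool card_unit big1_eq.
Qed.

Definition loop : hom node02 node10 := WHom loop_modular.

Lemma no_loop_back : hom node10 node02 -> False.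
Proof. by case=> p _; case: (fmap p true). Qed.

Lemma bool_inj_involutive (f : bool -> bool) : injective f -> involutive f.
Proof.
move=> fI; have := fI true false.
by case t: (f true); case s: (f false) => h; try (by have := h erefl);
  case; rewrite ?t ?s ?t ?s.
Qed.

(** With two flags, an endomorphism permutes them and is its own inverse. *)
Lemma node02_endo : endo_left_invertible node02.
Proof.
move=> p; exists p; case: p => p pP.
have fK : involutive (fmap p) := bool_inj_involutive (@fmap_inj _ _ p).
have gE f : ghost p f = f.
  by apply/eqP; rewrite ghost_fix -(fK f) codom_f.
split=> [[]|f|f] //=; first by case: (vmap p _).
by have /= := comp_ghost_in p p (fmap p f); rewrite fK !gE fK.
Qed.

Lemma modular_vertexless (x : modular) : (vert (dob x) -> False) -> x ≅ unit_ob.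
Proof.
move=> n; constructor.
pose i : @iso genus_agg x unit_ob := decorated_vertexless_iso n.
apply: (@wide_iso genus_agg _ modular_wide x unit_ob i).
- by apply: modular_relabel => // u; case: (n u).
- by apply: modular_relabel => // -[].
Qed.

Lemma node02_indecomposable (a b c : modular) :
  (a ⊗ b) ⊗ c ≅ node02 -> a ≅ unit_ob \/ b ≅ unit_ob.
Proof.
case=> i; have [vertK _ _] := bwdK i.
have unit_eq (u v : unit) : u = v by case: u; case: v.
have [n|n] := @retract_singleton_empty (vert (dob a)) (vert (dob b))
  (vert (dob c)) unit (vmap (wmor (fwd i))) (vmap (wmor (bwd i))) vertK unit_eq tt.
- by left; apply: modular_vertexless.
- by right; apply: modular_vertexless.
Qed.

(** * Props *)

Lemma prop_base_vertexless (x : prop_base) :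
  (vert (agg_of x) -> False) -> (x : props) ≅ unit_ob.
Proof.
move=> n; constructor.
pose i : @iso dir_agg0 x unit_ob := decorated_vertexless_iso n.
have to_unit : dir_mor (fwd i) by apply: dir_relabel => // -[].
have from_unit : dir_mor (bwd i).
  by apply: dir_relabel => // g; case: (n (bdry g)).
pose j : @iso dir_agg x unit_ob := @wide_iso dir_agg0 _ dir_wide x unit_ob i
  to_unit from_unit.
apply: adjoin_iso.
exact: (@wide_iso dir_agg _ prop_wide x unit_ob j (pm_iso j) (pm_iso (iso_inv j))).
Qed.

Definition vertexless (x : prop_base) : Prop := vert (agg_of x) -> False.

(** Base morphisms map vertices to vertices and u creates one, so vertices never
    disappear; in particular u cannot occur when the target is empty. *)
Lemma vertexless_source (x y : prop_base) (t : aterm prop_gen x y) :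
  vertexless y -> vertexless x /\ generator_free t.
Proof.
elim: t => {x y} [x y p|x y []|x y z s IHs t IHt|x x' y y' s IHs t IHt] /= n.
- by split=> // v; apply: n (vmap (mor_of (base_mor p)) v).
- by case: (n tt).
- have [/IHt[? ->] ->] := IHs n; split => //.
- have [m ->] := IHs (n \o inl); have [k ->] := IHt (n \o inr).
  by split=> // -[].
Qed.

Lemma props_unit_endo : endo_left_invertible (unit_ob : props).
Proof.
move=> e; exists (idm unit_ob); rewrite comp1m.
have [_ /(generator_free_ain prop_rel)[p ep]] :
  vertexless (unit_ob : props) /\ generator_free e by apply: vertexless_source => -[].
apply: aeq_trans ep _; apply: aeq_in.
by split=> -[].
Qed.

Lemma props_unit_indecomposable (a b c : props) :
  (a ⊗ b) ⊗ c ≅ unit_ob -> a ≅ unit_ob \/ b ≅ unit_ob.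
Proof.
case=> i; left; apply: prop_base_vertexless => v.
have [n _] : vertexless ((a ⊗ b) ⊗ c) /\ generator_free (fwd i).
  by apply: vertexless_source => -[].
exact: n (inl (inl v)).
Qed.

Lemma no_star11_to_unit : @hom props star11 unit_ob -> False.
Proof.
move=> t; have [n _] : vertexless star11 /\ generator_free t.
  by apply: vertexless_source => -[].
exact: n tt.
Qed.

Theorem corollary4p16 (M : smc) :
  ~ sm_equivalent modular (plus M) /\
  ~ sm_equivalent (nc modular) (plus M) /\
  ~ sm_equivalent props (plus M).
Proof.
split; last split.
- apply: plus_obstruction loop no_loop_back.
  + exact: node02_endo.
  + exact: node02_indecomposable.
- apply: (@plus_obstruction (nc modular) M (leaf node02) (leaf node10)).
  + move=> e; have [f ef] := nc_leaf_full e; have [h hf] := node02_endo f.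
    exists (leaf_mor h); rewrite ef -leaf_mor_comp -leaf_mor1.
    by apply: aeq_in; apply: feq_in.
  + exact: nc_leaf_indecomposable.
  + exact: leaf_mor loop.
  + by move=> t; have [f _] := nc_leaf_full t; exact: no_loop_back f.
- apply: (@plus_obstruction props M unit_ob star11).
  + exact: props_unit_endo.
  + exact: props_unit_indecomposable.
  + exact: (agen prop_gen Punit : @hom props unit_ob star11).
  + exact: no_star11_to_unit.
Qed.
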